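(* Let $\kappa,\mu\in\mathbb{R}$ be constants with $\kappa<0$, and let $(\mathcal{M}^{2n+1},\varphi,\zeta,\eta,g)$ be a compact $(\kappa,\mu)$-almost co-Kähler manifold. Then there is no $(m,\rho)$-quasi-Einstein structure $(g,\omega,\lambda_1)$ on $\mathcal{M}$ satisfying $D\omega=(\zeta\omega)\zeta$. That is, there do not exist a smooth function $\omega:\mathcal{M}\to\mathbb{R}$ and constants $\rho,\lambda_1\in\mathbb{R}$, $0<m\le\infty$, such that $D\omega=(\zeta\omega)\zeta$ and $$\mathrm{Ric}+\mathrm{Hess}\,\omega-\tfrac1m\,d\omega\otimes d\omega=(\rho\tau+\lambda_1)g.$$
   Context: Almost contact metric manifold: a smooth manifold $\mathcal{M}^{2n+1}$ with a $(1,1)$-tensor field $\varphi$, a vector field $\zeta$, a 1-form $\eta$ and a Riemannian metric $g$ such that $\varphi^2=-I+\eta\otimes\zeta$, $\eta(\zeta)=1$, and $g(\varphi E,\varphi F)=g(E,F)-\eta(E)\eta(F)$ for all vector fields $E,F$. Its fundamental 2-form is $\Phi(E,F)=g(E,\varphi F)$. It is almost co-Kähler if $d\eta=0$ and $d\Phi=0$. Set $h=\tfrac12\mathcal{L}_\zeta\varphi$ ($\mathcal{L}$ the Lie derivative). $\nabla$ is the Levi-Civita connection of $g$ and the curvature tensor is $K(E,F)=[\nabla_E,\nabla_F]-\nabla_{[E,F]}$. For constants $\kappa,\mu\in\mathbb{R}$, an almost co-Kähler manifold is a $(\kappa,\mu)$-almost co-Kähler manifold if $K(E,F)\zeta=\kappa(\eta(F)E-\eta(E)F)+\mu(\eta(F)hE-\eta(E)hF)$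 for all vector fields $E,F$. $\mathrm{Ric}$ is the Ricci tensor, $\tau$ the scalar curvature, $D\omega$ the gradient and $\mathrm{Hess}\,\omega$ the Hessian of $\omega$, all with respect to $g$; $\frac1m=0$ if $m=\infty$. Compact means compact without boundary.
   Formalization: The manifold is taken to be nonempty with n ≥ 1 (dimension at least 3); for n = 0 the claim fails: on a circle the (κ,μ)-condition holds for every κ, and constant ω with ρ = λ₁ = 0 is such a structure. *)

(* Defs.v *)
From HB Require Import structures.
From mathcomp Require Import all_boot all_order all_algebra.
From mathcomp Require Import all_classical all_reals all_analysis.

Set Implicit Arguments.
Unset Strict Implicit.
Unset Printing Implicit Defensive.

Import Order.TTheory GRing.Theory Num.Theory numFieldNormedType.Exports.

Local Open Scope classical_set_scope.
Local Open Scope ring_scope.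

(* As in O'Neill's "Semi-Riemannian geometry", vector fields on a manifold M
   are the derivations of the ring Cinf M of smooth real functions on M, and
   tensor fields are Cinf M-multilinear maps between modules of vector fields
   and Cinf M. *)

Section Smooth.
Variables (R : realType) (d : nat).
Implicit Types (A : set 'rV[R]_d) (f g : 'rV[R]_d -> R).

(* All partial derivatives of order <= k exist and are continuous on A; only
   meaningful for open A. *)
Fixpoint Ck (k : nat) A f : Prop :=
  (forall x, A x -> {for x, continuous f}) /\
  if k is k'.+1 then
    forall i : 'I_d, (forall x, A x -> derivable f x (delta_mx ord0 i)) /\
                     Ck k' A (fun x => 'D_(delta_mx ord0 i) f x)
  else True.

Definition smooth_on A f : Prop := forall k, Ck k A f.

Lemma Ck_cont k A f : Ck k A f -> forall x, A x -> {for x, continuous f}.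
Proof. by case: k => [|k] []. Qed.

Lemma CkW k A f : Ck k.+1 A f -> Ck k A f.
Proof.
elim: k f => [|k IH] f [fc fD]; split=> // i.
by have [Df /IH] := fD i.
Qed.

Lemma Ck_ext k A f g : open A -> (forall x, A x -> f x = g x) ->
  Ck k A f -> Ck k A g.
Proof.
move=> oA; elim: k f g => [|k IH] f g fg.
all: have near_fg x : A x -> \forall y \near x, f y = g y
  by move=> Ax; apply: filterS fg _; exact: open_nbhs_nbhs.
all: have cg : Ck 0 A f -> forall x, A x -> {for x, continuous g}.
1,3: move=> [cf _] x Ax; have := cf x Ax; rewrite /prop_for /continuous_at (fg x Ax);
  apply: cvg_trans.
1,2: exact: (near_eq_cvg (near_fg x Ax)).
- by move=> [cf _]; split=> //; apply: cg.
- move=> [cf Df]; split; first exact: cg.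
  move=> i; have [Di Ci] := Df i; split=> [x Ax|].
    by apply: near_eq_derivable (Di x Ax); exact: near_fg.
  by apply: IH Ci => x Ax; apply: near_eq_derive; exact: near_fg.
Qed.

Lemma Ck_cst k A (c : R) : open A -> Ck k A (fun=> c).
Proof.
move=> oA; elim: k c => [|k IH] c; split => //; try by move=> x _; exact: cst_continuous.
move=> i; split=> [x _|]; first exact: (derivable_cst c).
by apply: Ck_ext (IH 0) => // x _; rewrite (derive_cst c).
Qed.

Lemma CkD k A f g : open A -> Ck k A f -> Ck k A g -> Ck k A (fun x => f x + g x).
Proof.
move=> oA; elim: k f g => [|k IH] f g [cf Df] [cg Dg]; split => //.
1,2: by move=> x Ax; apply: (@continuousD _ _ _ f g); [exact: cf|exact: cg].
move=> i; have [[Dfi Cfi] [Dgi Cgi]] := (Df i, Dg i); split=> [x Ax|].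
  by apply: (@derivableD _ _ _ f g); [exact: Dfi|exact: Dgi].
apply: Ck_ext (IH _ _ Cfi Cgi) => // x Ax.
by rewrite -(@deriveD _ _ _ f g) //; [exact: Dfi|exact: Dgi].
Qed.

Lemma CkM k A f g : open A -> Ck k A f -> Ck k A g -> Ck k A (fun x => f x * g x).
Proof.
move=> oA; elim: k f g => [|k IH] f g Cf Cg; have [cf Df] := Cf; have [cg Dg] := Cg;
  split => //.
1,2: by move=> x Ax; apply: (@continuousM _ _ f g); [exact: cf|exact: cg].
move=> i; have [[Dfi Cfi] [Dgi Cgi]] := (Df i, Dg i); split=> [x Ax|].
  by apply: (@derivableM _ _ f g); [exact: Dfi|exact: Dgi].
have CD := CkD oA (IH _ _ (CkW Cf) Cgi) (IH _ _ (CkW Cg) Cfi).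
apply: Ck_ext CD => // x Ax.
by rewrite (@deriveM _ _ f g) //; [exact: Dfi|exact: Dgi].
Qed.

End Smooth.

(* chart_map and chart_inv are total; only their restrictions to chart_dom and
   to chart_img matter. *)
Record chart (R : realType) (d : nat) (M : topologicalType) := Chart {
  chart_dom : set M;
  chart_map : M -> 'rV[R]_d;
  chart_inv : 'rV[R]_d -> M;
  chart_dom_open : open chart_dom;
  chart_img_open : open (chart_map @` chart_dom);
  chart_mapK : forall p, chart_dom p -> chart_inv (chart_map p) = p;
  chart_map_cont : forall p, chart_dom p -> {for p, continuous chart_map};
  chart_inv_cont : forall x, (chart_map @` chart_dom) x ->
    {for x, continuous chart_inv} }.

Definition chart_img R d M (c : @chart R d M) : set 'rV[R]_d :=
  chart_map c @` chart_dom c.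

Definition smooth_transition R d M (c c' : @chart R d M) : Prop :=
  forall i : 'I_d,
    smooth_on (chart_map c @` (chart_dom c `&` chart_dom c'))
              (fun x => chart_map c' (chart_inv c x) ord0 i).

Record smoothManifold (R : realType) (d : nat) := SmoothManifold {
  mfd_carrier :> topologicalType;
  mfd_nonempty : [set: mfd_carrier] !=set0;
  mfd_hausdorff : hausdorff_space mfd_carrier;
  mfd_countable : @second_countable mfd_carrier;
  mfd_atlas : set (chart R d mfd_carrier);
  mfd_cover : forall p, exists2 c, mfd_atlas c & chart_dom c p;
  mfd_compatible : forall c c', mfd_atlas c -> mfd_atlas c' ->
    smooth_transition c c' }.

Section SmoothFunctions.
Variables (R : realType) (d : nat) (M : smoothManifold R d).

Definition smooth_fun : {pred M -> R} := fun f =>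
  `[< forall c, mfd_atlas c -> smooth_on (chart_img c) (f \o chart_inv c) >].

Lemma smooth_fun_cst (c : R) : (fun=> c) \in smooth_fun.
Proof. by apply/asboolP => u _ k; apply: Ck_cst; exact: chart_img_open. Qed.

Lemma smooth_fun_subring : subring_closed smooth_fun.
Proof.
have mulc f g : f \in smooth_fun -> g \in smooth_fun -> f * g \in smooth_fun.
  move=> /asboolP sf /asboolP sg; apply/asboolP => c ac k.
  by apply: CkM; [exact: chart_img_open|exact: sf|exact: sg].
split=> //; first exact: smooth_fun_cst.
move=> f g /asboolP sf sg.
have /asboolP sNg := mulc _ _ (smooth_fun_cst (-1)) sg.
apply/asboolP => c ac k.
apply: Ck_ext (CkD _ (sf c ac k) (sNg c ac k)); try exact: chart_img_open.
by move=> x _ /=; rewrite fctE mulN1r.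
Qed.

HB.instance Definition _ :=
  GRing.isSubringClosed.Build (M -> R) smooth_fun smooth_fun_subring.

Record Cinf := MkCinf {
  Cinf_fun :> M -> R;
  Cinf_smooth : Cinf_fun \in smooth_fun }.

HB.instance Definition _ := [isSub for Cinf_fun].
HB.instance Definition _ := [Choice of Cinf by <:].
HB.instance Definition _ := GRing.SubChoice_isSubComPzRing.Build _ _ Cinf
  (subringClosedP smooth_fun).

Definition Ccst (c : R) : Cinf := MkCinf (smooth_fun_cst c).

End SmoothFunctions.

Section VectorFields.
Variables (R : realType) (d : nat) (M : smoothManifold R d).
Notation C := (Cinf M).

Definition derivation : {pred C -> C^o} := fun X =>
  `[< (forall (c : R) (f g : C), X (Ccst M c * f + g) = Ccst M c * X f + X g) /\
      (forall f g : C, X (f * g) = f * X g + g * X f) >].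

Lemma derivation_submod : submod_closed derivation.
Proof.
split.
  have zE h : (0 : C -> C^o) h = 0 :> C by [].
  by apply/asboolP; split=> *; rewrite !zE !mulr0 addr0.
move=> a X Y /asboolP [XL XM] /asboolP [YL YM]; apply/asboolP.
have lE h : (a *: X + Y) h = a * X h + Y h :> C by [].
split=> [c f g|f g]; rewrite !lE.
  by rewrite XL YL !mulrDr addrACA mulrCA.
by rewrite XM YM !mulrDr addrACA (mulrCA a f) (mulrCA a g).
Qed.

HB.instance Definition _ :=
  GRing.isSubmodClosed.Build C (C -> C^o) derivation derivation_submod.

Record vecfield := MkVecfield {
  vf_fun : C -> C^o;
  vf_derivation : vf_fun \in derivation }.

HB.instance Definition _ := [isSub for vf_fun].
HB.instance Definition _ := [Choice of vecfield by <:].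
HB.instance Definition _ := [SubChoice_isSubLmodule of vecfield by <:].

Definition vf_apply (X : vecfield) : C -> C := vf_fun X.
Coercion vf_apply : vecfield >-> Funclass.

Lemma bracket_derivation (X Y : vecfield) :
  (fun f => X (Y f) - Y (X f) : C^o) \in derivation.
Proof.
rewrite /vf_apply; case: X Y => [X /asboolP [XL XM]] [Y /asboolP [YL YM]] /=.
apply/asboolP; split=> [c f g|f g].
  by rewrite XL !YL XL mulrBr opprD addrACA.
have XD h k : X (h + k) = X h + X k.
  by have := XL 1 h k; rewrite (_ : Ccst M 1 = 1) ?mul1r //; exact: val_inj.
have YD h k : Y (h + k) = Y h + Y k.
  by have := YL 1 h k; rewrite (_ : Ccst M 1 = 1) ?mul1r //; exact: val_inj.
rewrite YM XM XD YD !XM !YM !mulrBr (mulrC (X g)) (mulrC (X f)).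
rewrite [X in X - _]addrACA [X in _ - X]addrACA (addrC (Y f * _)).
set A := _ + g * X (Y f); set B := _ + g * Y (X f); set S := Y g * _ + _.
by rewrite opprD addrACA subrr addr0 opprD addrACA.
Qed.

Definition bracket (X Y : vecfield) : vecfield :=
  MkVecfield (bracket_derivation X Y).

End VectorFields.

Section Riemannian.
Variables (R : realType) (d : nat) (M : smoothManifold R d).
Notation C := (Cinf M).
Notation V := (vecfield M).

(* Every tangent vector at p extends to a vector field, and X vanishes at p
   exactly when X f p = 0 for all f: metric_pos is positive definiteness on
   each tangent space. *)
Record metric := Metric {
  metric_fun :> V -> V -> C;
  metric_linear : forall (f : C) X Y Z,
    metric_fun (f *: X + Y) Z = f * metric_fun X Z + metric_fun Y Z;
  metric_sym : forall X Y, metric_fun X Y = metric_fun Y X;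
  metric_pos : forall (X : V) (p : M),
    (exists f, X f p != 0) -> 0 < metric_fun X X p }.

Record connection := Connection {
  conn_fun :> V -> V -> V;
  conn_linear : forall (f : C) E E' F,
    conn_fun (f *: E + E') F = f *: conn_fun E F + conn_fun E' F;
  conn_additive : forall E F F',
    conn_fun E (F + F') = conn_fun E F + conn_fun E F';
  conn_leibniz : forall (E : V) (f : C) F,
    conn_fun E (f *: F) = E f *: F + f *: conn_fun E F }.

Definition levi_civita (g : metric) (nabla : connection) : Prop :=
  (forall E F, nabla E F - nabla F E = bracket E F) /\
  (forall X E F : V, X (g E F) = g (nabla X E) F + g E (nabla X F)).

Definition curvature (nabla : connection) (E F Z : V) : V :=
  nabla E (nabla F Z) - nabla F (nabla E Z) - nabla (bracket E F) Z.

Definition is_gradient (g : metric) (w : C) (D : V) : Prop :=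
  forall E, g D E = E w.

Definition hessian (nabla : connection) (w : C) (E F : V) : C :=
  E (F w) - nabla E F w.

Definition orthonormal_at (g : metric) (p : M) (e : 'I_d -> V) : Prop :=
  forall i j, g (e i) (e j) p = (i == j)%:R.

(* Vector fields whose values at p form an orthonormal basis of the tangent
   space at p: some basis exists at every p, and the traces below do not
   depend on which one is chosen. *)
Definition frame_at (g : metric) (p : M) : 'I_d -> V :=
  xget (fun=> 0) [set e | orthonormal_at g p e].

(* Ric(E,F) is the trace of Z |-> K(Z,E)F. *)
Definition ricci (g : metric) (nabla : connection) (E F : V) (p : M) : R :=
  \sum_i g (curvature nabla (frame_at g p i) E F) (frame_at g p i) p.

Definition scalar_curvature (g : metric) (nabla : connection) (p : M) : R :=
  \sum_i ricci g nabla (frame_at g p i) (frame_at g p i) p.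

(* For m = +oo the library's m^-1 is 0. *)
Definition quasi_einstein (g : metric) (nabla : connection)
    (m : \bar R) (rho : R) (w : C) (lambda1 : R) : Prop :=
  forall E F p,
    ricci g nabla E F p + hessian nabla w E F p
      - fine (m^-1)%E * (E w p * F w p)
    = (rho * scalar_curvature g nabla p + lambda1) * g E F p.

Record almost_contact_metric := AlmostContactMetric {
  acm_phi : {linear V -> V};
  acm_zeta : V;
  acm_eta : {linear V -> C^o};
  acm_metric : metric;
  acm_phi2 : forall E, acm_phi (acm_phi E) = - E + (acm_eta E : C) *: acm_zeta;
  acm_eta_zeta : acm_eta acm_zeta = 1;
  acm_compat : forall E F, acm_metric (acm_phi E) (acm_phi F) =
    acm_metric E F - acm_eta E * acm_eta F }.

Definition d1 (a : V -> C) (E F : V) : C :=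
  E (a F) - F (a E) - a (bracket E F).

Definition d2 (a : V -> V -> C) (E F G : V) : C :=
  E (a F G) + F (a G E) + G (a E F)
  - a (bracket E F) G - a (bracket F G) E - a (bracket G E) F.

Definition lie_derivative11 (Z : V) (A : V -> V) (E : V) : V :=
  bracket Z (A E) - A (bracket Z E).

Section AlmostCoKahler.
Variable S : almost_contact_metric.

Definition fundamental_form (E F : V) : C := acm_metric S E (acm_phi S F).

Definition acm_h (E : V) : V :=
  Ccst M 2^-1 *: lie_derivative11 (acm_zeta S) (acm_phi S) E.

Definition almost_cokahler : Prop :=
  (forall E F, d1 (acm_eta S) E F = 0) /\
  (forall E F G, d2 fundamental_form E F G = 0).

Definition kappa_mu_almost_cokahler (nabla : connection) (kappa mu : R) : Prop :=
  almost_cokahler /\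
  forall E F, curvature nabla E F (acm_zeta S) =
    Ccst M kappa *: ((acm_eta S F : C) *: E - (acm_eta S E : C) *: F) +
    Ccst M mu *: ((acm_eta S F : C) *: acm_h E - (acm_eta S E : C) *: acm_h F).

End AlmostCoKahler.
End Riemannian.

(* Main.v *)
Require Import Defs.
From mathcomp Require Import all_boot all_order all_algebra.
From mathcomp Require Import all_classical all_reals all_analysis.
From mathcomp Require Import ring lra.

(* At a maximum p of f = zeta(omega) the equation D omega = f zeta makes Hess omega
   equal to f(p) g(nabla zeta, .), which is trace-free and kills zeta. If Ric is
   2 n kappa eta^2 + mu g(h ., .), so that tau = 2 n kappa, then evaluating the
   quasi-Einstein equation on (zeta, zeta) and tracing it gives the same left side
   2 n kappa - f(p)^2/m for s and for (2 n + 1) s, where s = rho tau + lambda_1.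
   Hence s = 0 and f(p)^2/m = 2 n kappa < 0, which is absurd.

   The Ricci tensor is computed from the leaves of ker eta. With T E = nabla_E zeta,
   closedness of eta and Phi gives T symmetric, T phi = - phi T and h = phi T; the
   (kappa, mu) condition gives T^2 = - kappa on ker eta and makes T a Codazzi tensor
   along the leaves. A Codazzi tensor with constant square is parallel, and then
   closedness of Phi makes phi parallel as well, as phi exchanges the eigenbundles
   of T. A curvature tensor commuting with both T and phi vanishes, so the leaves
   are flat and the Gauss equation determines the whole curvature tensor.

   Orthonormal frames at a point require the usual facts about derivations of smooth
   functions: bump functions, Hadamard's lemma and the chain rule. *)

Set Implicit Arguments.
Unset Strict Implicit.
Unset Printing Implicit Defensive.

Import Order.TTheory GRing.Theory Num.Theory numFieldNormedType.Exports.
Local Open Scope classical_set_scope.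
Local Open Scope ring_scope.

(** * Smooth functions of several real variables *)

Section CkTheory.
Variables (R : realType) (d : nat).
Implicit Types (A B : set 'rV[R]_d) (f g : 'rV[R]_d -> R).

(** [Ck k A f] only constrains the total function [f] at the individual points of [A], so it can be
    checked point by point, on arbitrary sets [B]. *)
Lemma Ck_local k A f :
  (forall x, A x -> exists2 B, B x & Ck k B f) -> Ck k A f.
Proof.
elim: k f => [|k IH] f loc; split=> //.
- by move=> x /loc[B Bx [cf _]]; exact: cf.
- by move=> x /loc[B Bx [cf _]]; exact: cf.
move=> i; split=> [x /loc[B Bx [_ /(_ i)[Df _]]]|]; first exact: Df.
by apply: IH => x /loc[B Bx [_ /(_ i)[_ Cf]]]; exists B.
Qed.

Lemma Ck_subset k A B f : B `<=` A -> Ck k A f -> Ck k B f.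
Proof. by move=> BA Cf; apply: Ck_local => x /BA Ax; exists A. Qed.

Lemma Ck1 k A f : Ck k.+1 A f -> Ck 1 A f.
Proof.
move=> [cf Df]; split=> // i; have [Di Ci] := Df i.
by split=> //; split=> //; exact: Ck_cont Ci.
Qed.

Lemma Ck_sum k A (I : Type) (r : seq I) (F : I -> 'rV[R]_d -> R) : open A ->
  (forall i, Ck k A (F i)) -> Ck k A (fun x => \sum_(i <- r) F i x).
Proof.
move=> oA CF; elim: r => [|i r IH].
  by apply: Ck_ext (Ck_cst k 0 oA) => // x _; rewrite big_nil.
by apply: Ck_ext (CkD oA (CF i) IH) => // x _; rewrite big_cons.
Qed.

Lemma is_derive_coord (x v : 'rV[R]_d) (i : 'I_d) :
  is_derive x v (fun y : 'rV[R]_d => y ord0 i) (v ord0 i).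
Proof.
have E : (fun h : R => h^-1 *: (((h *: v + x) ord0 i : R) - x ord0 i)) @ 0^'
    --> v ord0 i.
  apply: (@cvg_trans _ ((fun=> v ord0 i) @ (0:R)^')); last exact: cvg_cst.
  apply: near_eq_cvg; near=> h.
  rewrite !mxE addrK [_ *: _]mulrA mulVf ?mul1r//.
  by near: h; exact: nbhs_dnbhs_neq.
by split; [apply/cvg_ex; eexists; exact: E|exact: cvg_lim E].
Unshelve. all: by end_near. Qed.

Lemma Ck_coord k A (i : 'I_d) : open A -> Ck k A (fun x => x ord0 i).
Proof.
move=> oA; case: k => [|k]; split=> //; try by move=> x _; exact: coord_continuous.
move=> j; split=> [x _|]; first by have [] := is_derive_coord x (delta_mx ord0 j) i.
apply: Ck_ext (Ck_cst k ((delta_mx ord0 j : 'rV[R]_d) ord0 i) oA) => // x _.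
by have [_ ->] := is_derive_coord x (delta_mx ord0 j) i.
Qed.

End CkTheory.

Section Lines.
Variables (R : realType) (U : normedModType R).

(** This makes one-variable calculus available for directional derivatives. *)
Lemma is_derive_line (f : U -> R) (x v : U) (s df : R) :
  is_derive (s *: v + x) v f df <->
  is_derive s 1 (fun h : R => f (h *: v + x)) df.
Proof.
suff E : (fun h : R => h^-1 *: ((f \o shift (s *: v + x)) (h *: v) - f (s *: v + x)))
       = (fun h : R => h^-1 *: (((fun h : R => f (h *: v + x)) \o shift s) (h *: (1:R))
           - f (s *: v + x))).
  by split=> -[Df df_]; split; move: Df df_;
    rewrite /derivable /derive E.
by apply/funext => h /=; rewrite [h *: 1]mulr1 scalerDl addrA.
Qed.

Lemma is_derive_comp1 (f : R -> R) (u : U -> R) (x v : U) (a b : R) :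
  is_derive (u x) 1 f a -> is_derive x v u b -> is_derive x v (f \o u) (a * b).
Proof.
have x0 : x = 0 *: v + x by rewrite scale0r add0r.
move=> Df; rewrite {1 2}x0 => /is_derive_line Du; apply/is_derive_line.
by apply: (@is_derive1_comp _ f (fun h : R => u (h *: v + x))) => //=; rewrite -x0.
Qed.

End Lines.

Lemma is_derive_mulr (R : realType) (a s : R) : is_derive s 1 (fun s => s * a) a.
Proof.
have D := @is_deriveM R R id (cst a) s 1 _ _ (is_derive_id _ _) (is_derive_cst _ _ _).
by apply: is_derive_eq D _; rewrite scaler0 add0r [_ *: _]mulr1.
Qed.

(** * A smooth function vanishing exactly on a half-line *)

Section Flat.
Variable R : realType.

(* All derivatives of exp(-1/x), extended by 0 to x <= 0, are combinations of the
   functions x^(-n) exp(-1/x), a family closed under differentiation. *)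
Definition flat_pow (n : nat) (x : R) : R :=
  if x <= 0 then 0 else x^-1 ^+ n * expR (- x^-1).

(** With [y = 1/x] this is the bound [y^(n+1) / (n+1)! <= exp y]. The remaining factor [x] yields
    the derivative at 0. *)
Lemma flat_pow_le n (x : R) : 0 < x -> `|flat_pow n x| <= (n.+1)`!%:R * x.
Proof.
move=> x0; rewrite /flat_pow (lt_geF x0) ger0_norm; last first.
  by rewrite mulr_ge0 ?expR_ge0// exprn_ge0// invr_ge0 ltW.
have y0 : 0 <= x^-1 by rewrite invr_ge0 ltW.
have cn0 : 0 < (n.+1)`!%:R :> R by rewrite ltr0n fact_gt0.
have := expR_ge1Dxn n y0 => E.
have {}E : x^-1 ^+ n.+1 <= (n.+1)`!%:R * expR x^-1.
  by rewrite mulrC -ler_pdivrMr//; apply: le_trans E; rewrite lerDr.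
rewrite expRN ler_pdivrMr ?expR_gt0//.
rewrite -(ler_pM2l (x := x^-1)) ?invr_gt0// -exprS.
suff -> : x^-1 * ((n.+1)`!%:R * x * expR x^-1) = (n.+1)`!%:R * expR x^-1 by [].
by move: (expR _) (_%:R) => e c; field; rewrite gt_eqF.
Qed.

Lemma is_derive_flat_pow n (x : R) :
  is_derive x 1 (flat_pow n) (flat_pow n.+2 x - n%:R * flat_pow n.+1 x).
Proof.
have [x0|x0|->] := ltgtP x 0.
- have -> : flat_pow n.+2 x - n%:R * flat_pow n.+1 x = 0.
    by rewrite /flat_pow (ltW x0) mulr0 subr0.
  apply: (@near_eq_is_derive R R R (cst 0)).
  near=> y; rewrite /flat_pow ltW//; near: y; exact: lt_nbhsl.
- apply: (@near_eq_is_derive R R R (fun x : R => x^-1 ^+ n * expR (- x^-1))).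
    by near=> y; rewrite /flat_pow lt_geF//; near: y; exact: lt_nbhsr.
  rewrite /flat_pow (lt_geF x0).
  have xn0 : x != 0 by rewrite gt_eqF.
  have DV : is_derive x 1 (fun y : R => y^-1) (- x ^- 2).
    have := @is_deriveV R id x 1 1 xn0 (is_derive_id _ _).
    by rewrite [_ *: _]mulr1.
  have DX := @is_deriveX R R (fun y : R => y^-1) n x 1 _ DV.
  have DE := @is_derive1_comp R expR (fun y => - y^-1) x _ _ (is_derive_expR _)
    (is_deriveN DV).
  have := is_deriveM DX DE.
  set F := _ * _ => DF; set G := (X in is_derive _ _ X _).
  have -> : G = F by apply/funext => y; rewrite /G /F !fctE.
  apply: is_derive_eq DF _; rewrite !fctE /= /GRing.scale /=.
  rewrite opprK -exprVn.
  by case: n {DX F G} => [|n]; rewrite ?expr0 ?mul0r ?mulr0 ?exprS /=; ring.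
have f0 k : flat_pow k 0 = 0 by rewrite /flat_pow lexx.
rewrite !f0 mulr0 subr0.
have E : (fun h : R => h^-1 *: ((flat_pow n \o shift 0) (h *: (1:R)) - flat_pow n 0))
    @ 0^' --> (0:R).
  apply/cvgr0Pnorm_le => e e0.
  have cn0 : 0 < (n.+2)`!%:R :> R by rewrite ltr0n fact_gt0.
  near=> h.
  have hn0 : h != 0 by near: h; exact: nbhs_dnbhs_neq.
  rewrite /= f0 subr0 addr0 [h *: _]mulr1 /GRing.scale /=.
  have [h0|h0] := leP h 0; first by rewrite /flat_pow h0 mulr0 normr0 ltW.
  (* For [h > 0] the difference quotient at 0 is the next function of the family, which
     [flat_pow_le] bounds by a multiple of [h]. *)
  have -> : h^-1 * flat_pow n h = flat_pow n.+1 h.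
    by rewrite /flat_pow (lt_geF h0) exprS mulrA.
  apply: le_trans (flat_pow_le _ h0) _.
  rewrite mulrC -ler_pdivlMr// (le_trans (ler_norm _))//.
  near: h; exact: nbhs_dnbhs (nbhs0_le (divr_gt0 e0 cn0)).
by split; [apply/cvg_ex; exists 0; exact: E|exact: cvg_lim E].
Unshelve. all: by end_near. Qed.

(** The induction on [k] treats all [n] at once, because a derivative involves the indices [n + 1]
    and [n + 2]. *)
Lemma Ck_flat_pow d k n (A : set 'rV[R]_d) (u : 'rV[R]_d -> R) : open A ->
  Ck k A u -> Ck k A (flat_pow n \o u).
Proof.
move=> oA; elim: k n u => [|k IH] n u Cu; have [cu Du] := Cu; split=> //.
1,2: move=> x Ax; apply: continuous_comp; first exact: cu;
  apply: differentiable_continuous; apply/derivable1_diffP;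
  by have [] := is_derive_flat_pow n (u x).
move=> i; have [Dui Cui] := Du i.
have D x : A x -> is_derive x (delta_mx ord0 i) (flat_pow n \o u)
    ((flat_pow n.+2 (u x) - n%:R * flat_pow n.+1 (u x)) * 'D_(delta_mx ord0 i) u x).
  move=> Ax; apply: is_derive_comp1; first exact: is_derive_flat_pow.
  by split=> //; exact: Dui.
split=> [x /D[]//|].
have C2 := IH n.+2 u (CkW Cu); have C1 := IH n.+1 u (CkW Cu).
have CC := CkM oA (CkD oA C2 (CkM oA (Ck_cst k (- n%:R) oA) C1)) Cui.
by apply: Ck_ext CC => // x /D[_ ->] /=; rewrite mulNr.
Qed.

End Flat.

Lemma cvg_row (R : realType) (d : nat) (T : Type) (F : set_system T)
    (FF : Filter F) (f : T -> 'rV[R]_d) (l : 'rV[R]_d) :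
  (forall i, f x ord0 i @[x --> F] --> l ord0 i) -> f x @[x --> F] --> l.
Proof.
move=> fl; apply/cvg_ballP => e e0.
have : \forall x \near F, forall i, ball (l ord0 i) e (f x ord0 i).
  apply: filter_forall => i; have /cvg_ballP := fl i; exact.
by apply: filterS => x Hx; split=> // i j; rewrite (ord1 i); exact: Hx.
Qed.

(** * Open cubes *)

Section Cube.
Variables (R : realType) (d : nat).

(** A cube is stable under shrinking each coordinate towards [q] by its own factor, which is the
    motion used for Hadamard's lemma. *)
Definition cube (q : 'rV[R]_d) (r : R) : set 'rV[R]_d :=
  [set y | forall i, `|y ord0 i - q ord0 i| < r].

Lemma nbhs_cube q r (y : 'rV[R]_d) : cube q r y -> nbhs y (cube q r).
Proof.
move=> yq; pose FF : Filter (nbhs y) := nbhs_filter y.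
apply: (@filter_forall _ 'I_d (fun i (z : 'rV[R]_d) => `|z ord0 i - q ord0 i| < r)
  (nbhs y) FF) => i.
have cc : {for y, continuous (fun z : 'rV[R]_d => `|z ord0 i - q ord0 i|)}.
  apply: continuous_comp; last exact: norm_continuous.
  by apply: continuousB; [exact: coord_continuous|exact: cst_continuous].
exact: (@cvgr_lt _ _ _ FF _ _ cc _ (yq i)).
Qed.

Lemma open_cube q r : open (cube q r).
Proof. rewrite openE => y; exact: nbhs_cube. Qed.

Lemma cube_center q r : 0 < r -> cube q r q.
Proof. by move=> r0 i; rewrite subrr normr0. Qed.

Lemma open_cubeP (A : set 'rV[R]_d) q : open A -> A q ->
  exists2 r, 0 < r & cube q r `<=` A.
Proof.
rewrite openE => oA /oA /nbhs_ballP[r /= r0 rA]; exists r => // y yq.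
apply: rA; split=> // i j; rewrite (ord1 i) -ball_normE /= distrC; exact: yq.
Qed.

End Cube.

Lemma Rintegral01_cst (R : realType) (a : R) :
  \int[@lebesgue_measure R]_(t in `[0, 1]) a = a.
Proof.
have m1 : @lebesgue_measure R `[0, 1]%classic = 1%E.
  by rewrite lebesgue_measure_itv /= lte_fin ltr01 oppr0 adde0.
rewrite Rintegral_cst//; transitivity (a * fine (1%E : \bar R)).
  by congr (_ * fine _).
by rewrite mulr1.
Qed.

Lemma Rintegral01_le (R : realType) (f : R -> R) (e : R) :
  (@lebesgue_measure R).-integrable `[0, 1] (EFin \o f) ->
  (forall t, `[0, 1]%classic t -> `|f t| <= e) ->
  `|\int[@lebesgue_measure R]_(t in `[0, 1]) f t| <= e.
Proof.
move=> intf fe; apply: le_trans (le_normr_Rintegral _ intf) _ => //.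
rewrite -[leRHS]Rintegral01_cst.
apply: le_Rintegral => //.
- exact: integrable_norm.
- apply: continuous_compact_integrable; first exact: segment_compact.
  by apply: continuous_subspaceT => x; exact: cst_continuous.
Qed.

(** * Differentiation of integrals depending on a point *)

Section ParametricIntegral.
Variables (R : realType) (d : nat) (q : 'rV[R]_d) (r : R).
Implicit Types (w : R -> R) (c : 'I_d -> R -> R) (g : 'rV[R]_d -> R).
Local Notation mu := (@lebesgue_measure R).
Local Notation Q := (cube q r).

Definition shrink c (t : R) (y : 'rV[R]_d) : 'rV[R]_d :=
  \row_k (q ord0 k + c k t * (y ord0 k - q ord0 k)).

(** The weight [w] closes the family under differentiation: a derivative in coordinate [k] replaces
    [w] by [w * c k] and [g] by its partial derivative. *)
Definition shrink_integral w c g (y : 'rV[R]_d) : R :=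
  \int[mu]_(t in `[0, 1]) (w t * g (shrink c t y)).

Lemma shrink_cube c t y : (forall k, 0 <= c k t <= 1) -> Q y -> Q (shrink c t y).
Proof.
move=> c01 yQ k; rewrite mxE addrAC subrr add0r normrM.
have /andP[c0 c1] := c01 k; rewrite ger0_norm//.
by apply: le_lt_trans (yQ k); rewrite ler_piMl.
Qed.

Lemma shrink_line c t (y : 'rV[R]_d) k s :
  shrink c t (s *: delta_mx ord0 k + y) =
  (s * c k t) *: delta_mx ord0 k + shrink c t y.
Proof.
apply/rowP => j; rewrite !mxE eqxx /=; case: eqP => [->|_] /=; rewrite ?mulr1 ?mulr0; ring.
Qed.

Lemma cvg_shrink c (t0 : R) y0 : (forall k, continuous (c k)) ->
  shrink c x.1 x.2 @[x --> (t0, y0)] --> shrink c t0 y0.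
Proof.
move=> cc; apply: cvg_row => k; rewrite mxE.
under eq_cvg do rewrite mxE.
apply: cvgD; first exact: cvg_cst.
apply: cvgM.
  apply: (@cvg_comp _ _ _ fst (c k)); [exact: cvg_fst|exact: cc].
apply: cvgB; last exact: cvg_cst.
apply: (@cvg_comp _ _ _ snd (fun y : 'rV[R]_d => y ord0 k)); first exact: cvg_snd.
exact: coord_continuous.
Qed.

Variables (c : 'I_d -> R -> R).
Hypothesis cc : forall k, continuous (c k).
Hypothesis c01 : forall k t, 0 <= t <= 1 -> 0 <= c k t <= 1.

Lemma cvg_integrand w g (t0 : R) y0 : continuous w -> Ck 0 Q g -> Q y0 -> 0 <= t0 <= 1 ->
  w x.1 * g (shrink c x.1 x.2) @[x --> (t0, y0)] --> w t0 * g (shrink c t0 y0).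
Proof.
move=> cw [cg _] yQ t01; apply: cvgM.
  apply: (@cvg_comp _ _ _ fst w); [exact: cvg_fst|exact: cw].
apply: (@cvg_comp _ _ _ (fun x => shrink c x.1 x.2) g); first exact: cvg_shrink.
by apply: cg; apply: shrink_cube => // k; exact: c01.
Qed.

(** The integrand is jointly continuous in [t] and [y], so compactness of [[0, 1]] makes the
    continuity at [y0] uniform in [t]. *)
Lemma integrand_tube w g y0 (e : R) : continuous w -> Ck 0 Q g -> Q y0 -> 0 < e ->
  \forall y \near y0, forall t, `[0, 1]%classic t ->
    `|w t * g (shrink c t y) - w t * g (shrink c t y0)| <= e.
Proof.
move=> cw Cg yQ e0.
have /compact_near_coveringP cov := @segment_compact R 0 1.
apply: (cov _ (nbhs y0) (fun y t =>
  `|w t * g (shrink c t y) - w t * g (shrink c t y0)| <= e)) => t0 /=.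
rewrite in_itv /= => t01.
have e20 : 0 < e / 2 by rewrite divr_gt0.
have /cvgrPdist_lt/(_ _ e20)[[U V] /= [U0 V0] UV] := cvg_integrand cw Cg yQ t01.
exists (U, V) => // -[t y] /= [Ut Vy].
have H1 := UV (t, y) (conj Ut Vy).
have H2 := UV (t, y0) (conj Ut (nbhs_singleton V0)).
rewrite /= in H1 H2; move: H1 H2; set a := w t0 * _; set b := w t * _; set b' := w t * _.
move=> H1 H2; rewrite (splitr e) (_ : b - b' = - (a - b) + (a - b')); last by ring.
by rewrite (le_trans (ler_normD _ _))// normrN lerD// ltW.
Qed.

Lemma continuous_integrand w g y (t : R) : continuous w -> Ck 0 Q g -> Q y ->
  0 <= t <= 1 -> {for t, continuous (fun t => w t * g (shrink c t y))}.
Proof.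
move=> cw Cg yQ t01 A /(cvg_integrand cw Cg yQ t01)[[U V] /= [Ut Vy] UV].
apply: filterS Ut => s Us.
by apply: (UV (s, y)); split => //=; exact: nbhs_singleton.
Qed.

Lemma integrable_integrand w g y : continuous w -> Ck 0 Q g -> Q y ->
  mu.-integrable `[0, 1] (EFin \o (fun t => w t * g (shrink c t y))).
Proof.
move=> cw Cg yQ; apply: continuous_compact_integrable; first exact: segment_compact.
apply: continuous_in_subspaceT => t; rewrite inE /= in_itv /= => t01.
exact: (continuous_integrand cw Cg yQ t01).
Qed.

Lemma shrink_integral_continuous w g y0 : continuous w -> Ck 0 Q g -> Q y0 ->
  {for y0, continuous (shrink_integral w c g)}.
Proof.
move=> cw Cg yQ; apply/(@cvgrPdist_le _ _ _ _ (nbhs_filter y0)) => e e0.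
have nQ := nbhs_cube yQ.
have T := integrand_tube cw Cg yQ e0.
apply: (@filterS2 _ (nbhs y0) (nbhs_filter y0) _ _ _ _ T nQ) => y Ty yQ'.
rewrite distrC /shrink_integral -RintegralB//; [|exact: integrable_integrand..].
apply: Rintegral01_le => //.
have := integrableB _ (integrable_integrand cw Cg yQ') (integrable_integrand cw Cg yQ).
move=> /(_ (measurable_itv _)).
by apply: eq_integrable => // t _ /=; rewrite EFinB.
Qed.

Lemma is_derive_integrand w g y k (t s : R) : Ck 1 Q g -> 0 <= t <= 1 ->
  Q (s *: delta_mx ord0 k + y) ->
  is_derive s 1 (fun s => w t * g (shrink c t (s *: delta_mx ord0 k + y)))
    (w t * c k t * 'D_(delta_mx ord0 k) g (shrink c t (s *: delta_mx ord0 k + y))).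
Proof.
move=> [_ /(_ k)[Dg _]] t01 yQ.
have shQ : Q (shrink c t (s *: delta_mx ord0 k + y)).
  by apply: shrink_cube yQ => j; exact: c01.
have /is_derive_line Dl : is_derive ((s * c k t) *: delta_mx ord0 k + shrink c t y)
    (delta_mx ord0 k) g
    ('D_(delta_mx ord0 k) g (shrink c t (s *: delta_mx ord0 k + y))).
  by rewrite shrink_line; split => //; apply: Dg; rewrite -shrink_line.
have DD := @is_derive1_comp R _ _ s _ _ Dl (is_derive_mulr _ _).
have := @is_deriveZ R R R _ (w t) s 1 _ DD.
set F := (X in is_derive _ _ X _); set G := (X in _ -> is_derive _ _ X _).
have -> : F = G by apply/funext => x; rewrite /F /G !fctE /= shrink_line.
by move=> D; apply: is_derive_eq D _; rewrite /GRing.scale /=; ring.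
Qed.

Lemma is_derive_shrink_integral w g y k : continuous w -> Ck 1 Q g -> Q y ->
  is_derive y (delta_mx ord0 k) (shrink_integral w c g)
    (shrink_integral (fun t => w t * c k t) c (fun x => 'D_(delta_mx ord0 k) g x) y).
Proof.
move=> cw Cg yQ; set v := delta_mx ord0 k.
have y0 : y = 0 *: v + y by rewrite scale0r add0r.
rewrite {1}y0; apply/is_derive_line.
have cwc : continuous (fun t => w t * c k t).
  by move=> t; apply: continuousM; [exact: cw|exact: cc].
have CDg : Ck 0 Q (fun x => 'D_v g x) by have [_ /(_ k)[_ []]] := Cg.
have nQ := nbhs_cube yQ.
(* With tolerance 1, the differentiated integrand stays near [y] within 1 of its value at [y], for
   all [t]. This provides the dominating function [G] for differentiation under the integral. *)
have T := integrand_tube cwc CDg yQ ltr01.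
have cl : {for (0:R), continuous (fun s : R => s *: v + y)}.
  apply: continuousD; last exact: cst_continuous.
  by apply: continuousZl; exact: cvg_id.
have [e /= e0 eQ] : \forall s \near (0:R), Q (s *: v + y) /\
   forall t, `[0, 1]%classic t ->
    `|w t * c k t * 'D_v g (shrink c t (s *: v + y)) -
      w t * c k t * 'D_v g (shrink c t y)| <= 1.
  apply: (cl (fun z => Q z /\ forall t, `[0, 1]%classic t ->
    `|w t * c k t * 'D_v g (shrink c t z) -
      w t * c k t * 'D_v g (shrink c t y)| <= 1)).
  by rewrite scale0r add0r; apply: (@filterS2 _ _ (nbhs_filter y) _ _ _ _ nQ T).
have {}eQ s : `]- e, e[%classic s -> Q (s *: v + y) /\
   forall t, `[0, 1]%classic t ->
    `|w t * c k t * 'D_v g (shrink c t (s *: v + y)) -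
      w t * c k t * 'D_v g (shrink c t y)| <= 1.
  by rewrite /= in_itv /= => se; apply: eQ; rewrite /= sub0r normrN ltr_norml.
pose f s t := w t * g (shrink c t (s *: v + y)).
have Df s t : `]- e, e[%classic s -> `[0, 1]%classic t ->
    is_derive s 1 (f ^~ t) (w t * c k t * 'D_v g (shrink c t (s *: v + y))).
  move=> /eQ[Qs _]; rewrite /= in_itv /= => t01.
  exact: is_derive_integrand.
have e0' : `]- e, e[%classic 0 by rewrite /= in_itv /= oppr_lt0 e0.
pose G t := `|w t * c k t * 'D_v g (shrink c t y)| + 1.
have G_ge0 t : 0 <= G t by rewrite addr_ge0.
have intG : mu.-integrable `[0, 1] (EFin \o G).
  have cst1 : mu.-integrable `[0, 1] (EFin \o cst (1:R)).
    apply: continuous_compact_integrable; first exact: segment_compact.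
    by apply: continuous_subspaceT => x; exact: cst_continuous.
  have := integrableD _ (integrable_norm (integrable_integrand cwc CDg yQ)) cst1.
  move=> /(_ (measurable_itv _)).
  by apply: eq_integrable => // t _ /=; rewrite EFinD.
have intf s : `]- e, e[%classic s -> mu.-integrable `[0, 1] (EFin \o f s).
  by move=> /eQ[Qs _]; apply: integrable_integrand => //; exact: CkW Cg.
have derf s t : `]- e, e[%classic s -> `[0, 1]%classic t -> derivable (f ^~ t) s 1.
  by move=> se /(Df _ _ se)[].
have Gub s t : `]- e, e[%classic s -> `[0, 1]%classic t -> `|partial1of2 f s t| <= G t.
  move=> se t01; rewrite partial1of2E; have [_ ->] := Df _ _ se t01.
  have [_ /(_ _ t01)] := eQ _ se; rewrite /G.
  set a := _ * _; set b := w t * c k t * 'D_v g (shrink c t y) => ab1.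
  by rewrite -lerBlDl (le_trans _ ab1)// lerB_dist.
have mI : measurable (`[0, 1]%classic : set (measurableTypeR R)) by exact: measurable_itv.
split.
  exact: (@derivable_under_integral R _ (measurableTypeR R) mu f _ mI 0 (- e) e e0'
    intf derf G G_ge0 intG Gub).
rewrite -derive1E (@differentiation_under_integral R _ (measurableTypeR R) mu f _ mI 0
  (- e) e e0' intf derf G G_ge0 intG Gub).
apply: eq_Rintegral => t; rewrite inE => t01.
rewrite partial1of2E; have [_ ->] := Df _ _ e0' t01.
by rewrite scale0r add0r.
Qed.

Lemma Ck_shrink_integral n w g : continuous w -> Ck n Q g ->
  Ck n Q (shrink_integral w c g).
Proof.
elim: n w g => [|n IH] w g cw Cg.
  by split=> // y Qy; exact: shrink_integral_continuous.
have C0 : Ck 0 Q g by split => //; have [] := Cg.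
have C1 := Ck1 Cg.
split=> [y Qy|k]; first exact: shrink_integral_continuous.
have D y : Q y -> _ := fun Qy => is_derive_shrink_integral k cw C1 Qy.
split=> [y /D[]//|].
have cwc : continuous (fun t => w t * c k t).
  by move=> t; apply: continuousM; [exact: cw|exact: cc].
have [_ /(_ k)[_ CDg]] := Cg.
by apply: Ck_ext (IH _ _ cwc CDg); [exact: open_cube|move=> y /D[_ ->]].
Qed.

End ParametricIntegral.

(** * Hadamard's lemma *)

Section Hadamard.
Variables (R : realType) (d : nat) (q : 'rV[R]_d) (r : R).
Local Notation Q := (cube q r).
Local Notation "'ee' j" := (delta_mx ord0 j : 'rV[R]_d) (at level 10).

(* [f y - f q] is split by moving from [q] to [y] one coordinate at a time: this is
   the weight of coordinate [k] while coordinate [j] moves. Unlike the segment from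
   [q] to [y], this only needs partial derivatives along the axes, so Hadamard's
   lemma is available before the chain rule, which follows from it. *)
Definition step_weight (j k : 'I_d) (t : R) : R :=
  if (k < j)%N then 1 else if k == j then t else 0.

(** This is the mean of the [j]-th partial derivative over the edge of the staircase path from [q]
    to [y] on which coordinate [j] moves. *)
Definition hadamard_quot (f : 'rV[R]_d -> R) (j : 'I_d) : 'rV[R]_d -> R :=
  shrink_integral q (fun=> 1) (step_weight j) (fun x => 'D_(ee j) f x).

Lemma continuous_step_weight j k : continuous (step_weight j k).
Proof.
have -> : step_weight j k =
    if (k < j)%N then cst 1 else if k == j then id else cst 0.
  by apply/funext => t; rewrite /step_weight; case: (k < j)%N; case: (k == j).
case: ifP => _; first by move=> ?; exact: cst_continuous.
by case: ifP => _ ?; [exact: cvg_id|exact: cst_continuous].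
Qed.

Lemma step_weight01 j k t : 0 <= t <= 1 -> 0 <= step_weight j k t <= 1.
Proof.
move=> t01; rewrite /step_weight.
by case: (k < j)%N; [rewrite ler01 lexx|case: (k == j); rewrite // lexx ler01].
Qed.

Lemma Ck_hadamard_quot n f j : Ck n.+1 Q f -> Ck n Q (hadamard_quot f j).
Proof.
move=> [_ /(_ j)[_ CDf]]; apply: Ck_shrink_integral CDf.
- exact: continuous_step_weight.
- exact: step_weight01.
- exact: cst_continuous.
Qed.

Lemma hadamard_quot_center f j : hadamard_quot f j q = 'D_(ee j) f q.
Proof.
have E t : shrink q (step_weight j) t q = q.
  by apply/rowP => k; rewrite mxE subrr mulr0 addr0.
rewrite /hadamard_quot /shrink_integral; under eq_Rintegral do rewrite E mul1r.
exact: Rintegral01_cst.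
Qed.

Definition partial_pt (y : 'rV[R]_d) (m : nat) : 'rV[R]_d :=
  \row_k (if (k < m)%N then y ord0 k else q ord0 k).

Lemma shrink_step_weight y (j : 'I_d) t : shrink q (step_weight j) t y =
  (t * (y ord0 j - q ord0 j)) *: ee j + partial_pt y j.
Proof.
apply/rowP => k; rewrite !mxE eqxx /= /step_weight.
have [kj|jk|/val_inj ->] := ltngtP k j; rewrite ?eqxx /=; last by ring.
- have -> : (k == j) = false by apply/eqP => E; rewrite E ltnn in kj.
  by rewrite mulr0; ring.
- have -> : (k == j) = false by apply/eqP => E; rewrite E ltnn in jk.
  by rewrite mulr0; ring.
Qed.

(** Fundamental theorem of calculus on edge [j] of the staircase, parametrised by [F] over
    [[0, 1]]. *)
Lemma hadamard_step f y (j : 'I_d) : Ck 1 Q f -> Q y ->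
  f (partial_pt y j.+1) - f (partial_pt y j) =
  (y ord0 j - q ord0 j) * hadamard_quot f j y.
Proof.
move=> Cf yQ; have [_ /(_ j)[Dj Cj]] := Cf.
pose a := y ord0 j - q ord0 j.
have shQ t : 0 <= t <= 1 -> Q (shrink q (step_weight j) t y).
  by move=> t01; apply: shrink_cube yQ => k; exact: step_weight01.
pose F (t : R) := f ((t * a) *: ee j + partial_pt y j).
have DF (t : R) : 0 <= t <= 1 ->
    is_derive t 1 F (a * 'D_(ee j) f (shrink q (step_weight j) t y)).
  move=> t01.
  have /is_derive_line Dl : is_derive ((t * a) *: ee j + partial_pt y j) (ee j) f
      ('D_(ee j) f (shrink q (step_weight j) t y)).
    by rewrite -shrink_step_weight; split=> //; apply: Dj; exact: shQ.
  by have := @is_derive1_comp R _ _ t _ _ Dl (is_derive_mulr _ _); rewrite mulrC.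
have cF (t : R) : 0 <= t <= 1 -> {for t, continuous F}.
  by move=> /DF[/derivable1_diffP D _]; exact: differentiable_continuous.
have E1 : F 1 = f (partial_pt y j.+1).
  rewrite /F; congr f; apply/rowP => k; rewrite !mxE eqxx /= ltnS mul1r.
  have [kj|jk|/val_inj ->] := ltngtP k j; rewrite ?eqxx /=.
  - have -> : (k == j) = false by apply/eqP => E; rewrite E ltnn in kj.
    by rewrite mulr0 add0r.
  - have -> : (k == j) = false by apply/eqP => E; rewrite E ltnn in jk.
    by rewrite mulr0 add0r.
  - by rewrite mulr1 subrK.
have E0 : F 0 = f (partial_pt y j).
  by rewrite /F mul0r scale0r add0r.
have Cj0 : Ck 0 Q (fun x => 'D_(ee j) f x) by [].
have cD : {within `[0, 1], continuous
    (fun t => a * 'D_(ee j) f (shrink q (step_weight j) t y))}.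
  apply: continuous_in_subspaceT => t; rewrite inE /= in_itv /= => t01.
  exact: (continuous_integrand (@continuous_step_weight j) (@step_weight01 j)
    (w := fun=> a) (fun=> cvg_cst _) Cj0 yQ t01).
have ineq (t : R) : t \in `]0, 1[ -> 0 <= t <= 1.
  by rewrite in_itv /= => /andP[t0 t1]; rewrite !ltW.
have oo : derivable_oo_LRcontinuous F 0 1.
  split; first by move=> t /ineq /DF[].
  - by apply: cvg_at_right_filter; apply: cF; rewrite lexx ler01.
  - by apply: cvg_at_left_filter; apply: cF; rewrite lexx ler01.
have := continuous_FTC2 ltr01 cD oo.
have FE : {in `]0, 1[, F^`()%classic =1
    (fun t => a * 'D_(ee j) f (shrink q (step_weight j) t y))}.
  by move=> t /ineq /DF[_]; rewrite derive1E.
move=> /(_ FE) /(congr1 fine) /=; rewrite E1 E0 => <-.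
rewrite /hadamard_quot /shrink_integral.
have int := integrable_integrand (@continuous_step_weight j) (@step_weight01 j)
    (w := fun=> 1) (@cst_continuous _ _ _) Cj0 yQ.
have mI : measurable (`[0, 1]%classic : set (measurableTypeR R)) by exact: measurable_itv.
rewrite -/a -(RintegralZl a mI int).
by apply: eq_Rintegral => t _; rewrite mul1r.
Qed.

Lemma hadamard f y : Ck 1 Q f -> Q y ->
  f y = f q + \sum_j (y ord0 j - q ord0 j) * hadamard_quot f j y.
Proof.
move=> Cf yQ; apply/eqP; rewrite addrC -subr_eq; apply/eqP.
have -> : f y - f q = \sum_(0 <= m < d) (f (partial_pt y m.+1) - f (partial_pt y m)).
  rewrite telescope_sumr//; congr (f _ - f _); apply/rowP => k; rewrite mxE//.
  by rewrite ltn_ord.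
by rewrite big_mkord; apply: eq_bigr => j _; exact: hadamard_step.
Qed.

End Hadamard.

(** * The chain rule *)

Section ChainRule.
Variable R : realType.

(** At a zero of [v] the product rule only asks continuity of [u]. Hadamard quotients of a [C^1]
    function provide no more than that. *)
Lemma is_derive_mul0 (u v : R -> R) (b : R) : {for (0:R), continuous u} ->
  is_derive (0:R) (1:R) v b -> v 0 = 0 ->
  is_derive (0:R) (1:R) (fun s => v s * u s) (b * u 0).
Proof.
move=> cu [/cvg_ex[/= l Dv] vb] v0.
have {vb} lb : l = b by rewrite -vb; apply/esym; exact: cvg_lim Dv.
move: Dv; rewrite {}lb => Dv.
have E : (fun h : R => h^-1 *: (((fun s => v s * u s) \o shift 0) (h *: (1:R))
     - v 0 * u 0)) @ 0^' --> b * u 0.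
  have -> : (fun h : R => h^-1 *: (((fun s => v s * u s) \o shift 0) (h *: (1:R))
     - v 0 * u 0)) = (fun h : R => h^-1 *: ((v \o shift 0) (h *: (1:R)) - v 0))
     \* u.
    apply/funext => h /=; rewrite v0 mul0r !subr0 addr0 [h *: 1]mulr1.
    by rewrite /GRing.scale /= mulrA.
  by apply: cvgM Dv _; apply: cvg_within_filter; exact: cu.
by split; [apply/cvg_ex; eexists; exact: E|exact: cvg_lim E].
Qed.

(** Hadamard's lemma at [phi x] writes the increment of [f \o phi] as a sum of products of a
    coordinate increment, which vanishes at [x], and a continuous quotient. Each product falls under
    [is_derive_mul0]. *)
Lemma is_derive_comp_vec m d (f : 'rV[R]_d -> R) (phi : 'rV[R]_m -> 'rV[R]_d)
    (x v : 'rV[R]_m) (dphi : 'I_d -> R) (r : R) :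
  0 < r -> Ck 1 (cube (phi x) r) f ->
  (forall j, is_derive x v (fun y => phi y ord0 j) (dphi j)) ->
  is_derive x v (f \o phi) (\sum_j 'D_(delta_mx ord0 j) f (phi x) * dphi j).
Proof.
move=> r0 Cf Dphi.
have x0 : x = 0 *: v + x by rewrite scale0r add0r.
pose gam (s : R) := phi (s *: v + x).
have gam0 : gam 0 = phi x by rewrite /gam -x0.
have Dgam j : is_derive (0:R) 1 (fun s => gam s ord0 j) (dphi j).
  by apply/(@is_derive_line _ _ (fun y => phi y ord0 j)); rewrite -x0.
have cgam : {for (0:R), continuous gam}.
  apply: cvg_row => j; have [/derivable1_diffP D _] := Dgam j.
  exact: (differentiable_continuous D).
rewrite {1}x0; apply/is_derive_line.
pose h j s := hadamard_quot (phi x) f j (gam s).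
have ch j : {for (0:R), continuous (h j)}.
  apply: (@continuous_comp _ _ _ gam (hadamard_quot (phi x) f j)) => //.
  have [c _] := Ck_hadamard_quot j Cf.
  by rewrite gam0; apply: c; exact: cube_center.
pose T j (s : R) := (gam s ord0 j - phi x ord0 j) * h j s.
have DT j : is_derive (0:R) 1 (T j) ('D_(delta_mx ord0 j) f (phi x) * dphi j).
  have Dv : is_derive (0:R) 1 (fun s => gam s ord0 j - phi x ord0 j) (dphi j).
    have := is_deriveB (Dgam j) (is_derive_cst (phi x ord0 j) (0:R) 1).
    by move=> D; apply: is_derive_eq D _; rewrite subr0.
  have v0 : gam 0 ord0 j - phi x ord0 j = 0 by rewrite gam0 subrr.
  have := is_derive_mul0 (ch j) Dv v0.
  by rewrite /h gam0 hadamard_quot_center mulrC.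
have DS := is_deriveD (is_derive_cst (f (phi x)) (0:R) (1:R)) (is_derive_sum (h := T) DT).
rewrite add0r in DS.
refine (@near_eq_is_derive R R R _ _ _ _ _ _ DS).
have nQ : nbhs (gam 0) (cube (phi x) r).
  by rewrite gam0; apply: nbhs_cube; exact: cube_center.
apply: (@filterS _ (nbhs (0:R)) (nbhs_filter _) _ _ _ (cgam _ nQ)) => s /= Qs.
by rewrite !fctE fct_sumE /= (hadamard Cf Qs).
Qed.

Lemma Ck_comp k m d (A : set 'rV[R]_m) (B : set 'rV[R]_d) (f : 'rV[R]_d -> R)
    (phi : 'rV[R]_m -> 'rV[R]_d) :
  open A -> open B -> (forall x, A x -> B (phi x)) -> Ck k B f ->
  (forall j, Ck k A (fun x => phi x ord0 j)) -> Ck k A (f \o phi).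
Proof.
move=> oA oB AB.
have cont (g : 'rV[R]_d -> R) : (forall j, Ck 0 A (fun x => phi x ord0 j)) ->
    (forall x, B x -> {for x, continuous g}) ->
    forall x, A x -> {for x, continuous (g \o phi)}.
  move=> Cphi cg x Ax; apply: (@continuous_comp _ _ _ phi g); last exact: cg (AB _ Ax).
  by apply: (cvg_row (nbhs_filter x)) => j; have [c _] := Cphi j; exact: c.
elim: k f => [|k IH] f Cf Cphi; split => //.
- by apply: cont => //; have [] := Cf.
- apply: cont; last by have [] := Cf.
  by move=> j; split=> //; have [] := Cphi j.
move=> i; pose v : 'rV[R]_m := delta_mx ord0 i.
have C1 := Ck1 Cf.
have D x : A x -> is_derive x v (f \o phi)
   (\sum_j 'D_(delta_mx ord0 j) f (phi x) * 'D_v (fun x => phi x ord0 j) x).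
  move=> Ax; have [r r0 rB] := open_cubeP oB (AB _ Ax).
  apply: (is_derive_comp_vec r0); first exact: Ck_subset C1.
  by move=> j; have [_ /(_ i)[Dj _]] := Cphi j; split => //; exact: Dj.
split=> [x /D[]//|].
apply: (@Ck_ext _ _ _ _ (fun x => \sum_j ((fun y => 'D_(delta_mx ord0 j) f y) \o phi) x *
   'D_v (fun x => phi x ord0 j) x)) => //.
  by move=> x /D[_ ->].
apply: Ck_sum => // j; apply: CkM => //; last by have [_ /(_ i)[]] := Cphi j.
apply: IH; first by have [_ /(_ j)[]] := Cf.
by move=> j'; exact: CkW.
Qed.

End ChainRule.

(** * Bump functions and local bases of vector fields *)

Section Bump.
Variables (R : realType) (d : nat).
Implicit Types (x y : 'rV[R]_d) (r : R).

(** The Euclidean distance keeps the argument polynomial. The support is the closed Euclidean ball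
    of radius [r], which lies in [closed_cube x r]. *)
Definition cube_bump x r y : R :=
  flat_pow 0 (r ^+ 2 - \sum_i (y ord0 i - x ord0 i) ^+ 2).

Definition closed_cube x r : set 'rV[R]_d :=
  [set y | forall i, `[x ord0 i - r, x ord0 i + r]%classic (y ord0 i)].

Lemma compact_closed_cube x r : compact (closed_cube x r).
Proof.
apply: (@rV_compact R d (fun i => `[x ord0 i - r, x ord0 i + r]%classic)) => i.
exact: segment_compact.
Qed.

Lemma closed_cube_sub x r s : r < s -> closed_cube x r `<=` cube x s.
Proof.
move=> rs y yx i; have := yx i; rewrite /= in_itv /= => /andP[h1 h2].
by rewrite ltr_norml; apply/andP; split; lra.
Qed.

Lemma cube_bump_out x r y : 0 < r -> ~ closed_cube x r y -> cube_bump x r y = 0.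
Proof.
move=> r0 /existsNP[i]; rewrite /= in_itv /= => /negP H.
rewrite /cube_bump /flat_pow ifT// subr_le0 (bigD1 i)//=.
apply: (@le_trans _ _ ((y ord0 i - x ord0 i) ^+ 2)); last first.
  by rewrite lerDl sumr_ge0// => j _; exact: sqr_ge0.
rewrite -[leRHS]real_normK ?num_real// ler_pXn2r ?nnegrE ?normr_ge0 ?(ltW r0)//.
rewrite leNgt; apply: contra H; rewrite ltr_norml => /andP[h1 h2].
by apply/andP; split; lra.
Qed.

Lemma cube_bump_center x r : 0 < r -> cube_bump x r x != 0.
Proof.
move=> r0; rewrite /cube_bump /flat_pow big1 ?subr0; last first.
  by move=> i _; rewrite subrr expr0n.
by rewrite lt_geF ?exprn_gt0// expr0 mul1r gt_eqF// expR_gt0.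
Qed.

Lemma smooth_cube_bump A x r : open A -> smooth_on A (cube_bump x r).
Proof.
move=> oA k; apply: (@Ck_flat_pow _ _ k 0 A) => //.
have Cs : Ck k A (fun y => \sum_i (y ord0 i - x ord0 i) ^+ 2).
  apply: Ck_sum => // i.
  have C1 := CkD oA (Ck_coord k i oA) (Ck_cst k (- x ord0 i) oA).
  exact: (CkM oA C1 C1).
apply: Ck_ext (CkD oA (Ck_cst k (r ^+ 2) oA) (CkM oA (Ck_cst k (- 1) oA) Cs)) => //.
by move=> y _; rewrite mulN1r.
Qed.

End Bump.

(** * Extension by zero from a chart *)

Section Extension.
Variables (R : realType) (d : nat) (M : smoothManifold R d).

Lemma open_chart_image (c : chart R d M) (U : set M) : open U ->
  open (chart_map c @` (chart_dom c `&` U)).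
Proof.
move=> oU; have := @chart_img_open _ _ _ c; rewrite !openE => oI x /= [p [cp Up] px].
have Ix : (chart_map c @` chart_dom c) x by exists p.
have ix : chart_inv c x = p by rewrite -px chart_mapK.
have nU : nbhs (chart_inv c x) U by rewrite ix; apply: open_nbhs_nbhs.
have := chart_inv_cont Ix nU; rewrite /interior => nU'.
apply: (@filterS2 _ _ (nbhs_filter x) _ _ _ _ (oI _ Ix) nU') => y [q cq qy] /= Uy.
by exists q => //; split=> //; move: Uy; rewrite -qy chart_mapK.
Qed.

(** Smoothness is local: near points of the chart mapped into [U] it follows from the transition
    maps and the chain rule, and near all other points the extension vanishes. *)
Lemma chart_extension (c : chart R d M) (U K : set 'rV[R]_d) (w : 'rV[R]_d -> R) :
  mfd_atlas c -> open U -> compact K -> K `<=` U -> U `<=` chart_img c ->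
  smooth_on U w -> (forall x, ~ K x -> w x = 0) ->
  exists F : Cinf M, (forall q, chart_dom c q -> F q = w (chart_map c q)) /\
    (forall q, ~ chart_dom c q -> F q = 0).
Proof.
move=> ac oU cK KU Uc sw w0.
pose F q := if `[< chart_dom c q >] then w (chart_map c q) else 0.
have FE q : chart_dom c q -> F q = w (chart_map c q).
  by move=> cq; rewrite /F asboolT.
have F0 q : ~ chart_dom c q -> F q = 0 by move=> cq; rewrite /F asboolF.
suff sF : F \in @smooth_fun R d M by exists (MkCinf sF).
apply/asboolP => c' ac' k; apply: Ck_local => x [q c'q <-{x}].
pose W := chart_dom c `&` chart_map c @^-1` U.
have oW : open W.
  rewrite openE => s [cs Us].
  have n1 : nbhs s (chart_dom c) by apply: open_nbhs_nbhs; split=> //; exact: chart_dom_open.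
  have n2 : nbhs s (chart_map c @^-1` U).
    by apply: (chart_map_cont cs); apply: open_nbhs_nbhs.
  exact: filterI.
have [Wq|nWq] := pselect (W q).
  exists (chart_map c' @` (chart_dom c' `&` W)); first by exists q.
  apply: (@Ck_ext _ _ _ _ (w \o (fun x => chart_map c (chart_inv c' x)))).
  - exact: open_chart_image.
  - by move=> _ [s [c's [cs Us]] <-] /=; rewrite chart_mapK// FE.
  apply: (Ck_comp (B := U)) => //.
  - exact: open_chart_image.
  - by move=> _ [s [c's [cs Us]] <-] /=; rewrite chart_mapK.
  - move=> j; apply: Ck_subset (mfd_compatible ac' ac j k).
    by move=> _ [s [c's [cs Us]] <-]; exists s.
(* [L] is compact, hence closed in the Hausdorff space [M]. Its complement is thus an open set
   around [q] on which [F] is zero. *)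
pose L := chart_inv c @` K.
have cL : closed L.
  apply: compact_closed; first exact: mfd_hausdorff.
  apply: continuous_compact => //; apply: continuous_in_subspaceT => x.
  by rewrite inE => /KU/Uc; exact: chart_inv_cont.
have nLq : ~ L q.
  move=> [x Kx xq]; apply: nWq; have [s cs sx] := Uc _ (KU _ Kx).
  move: xq; rewrite -sx chart_mapK// => <-; split=> //.
  by rewrite /= sx; exact: KU.
have oL : open (~` L) by exact: closed_openC.
exists (chart_map c' @` (chart_dom c' `&` ~` L)); first by exists q.
apply: (@Ck_ext _ _ _ _ (fun=> 0)); last by apply: Ck_cst; exact: open_chart_image.
  exact: open_chart_image.
move=> _ [s [c's nLs] <-] /=; rewrite chart_mapK//.
have [cs|ncs] := pselect (chart_dom c s); last by rewrite F0.
rewrite FE// w0// => Ks; apply: nLs; exists (chart_map c s) => //.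
by rewrite chart_mapK.
Qed.

Lemma chart_bump_extension (c : chart R d M) (x : 'rV[R]_d) (r s : R) (u : 'rV[R]_d -> R) :
  mfd_atlas c -> 0 < r -> r < s -> cube x s `<=` chart_img c ->
  smooth_on (cube x s) u ->
  exists F : Cinf M,
    (forall q, chart_dom c q -> F q = cube_bump x r (chart_map c q) * u (chart_map c q)) /\
    (forall q, ~ chart_dom c q -> F q = 0).
Proof.
move=> ac r0 rs xs su.
apply: (@chart_extension c (cube x s) (closed_cube x r) (fun y => cube_bump x r y * u y)) => //.
- exact: open_cube.
- exact: compact_closed_cube.
- exact: closed_cube_sub.
- by move=> k; apply: CkM (su k); [exact: open_cube|apply: smooth_cube_bump; exact: open_cube].
- by move=> y /(cube_bump_out r0) ->; rewrite mul0r.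
Qed.

End Extension.

(** * Pointwise calculus of smooth functions and derivations *)

Section Fields.
Variables (R : realType) (d : nat) (M : smoothManifold R d).
Notation C := (Cinf M).
Notation V := (vecfield M).
Implicit Types (f g : C) (X Y : V) (p q : M).

Lemma CinfP f g : (forall p, f p = g p) -> f = g.
Proof. by move=> fg; apply: val_inj; apply/funext. Qed.

Lemma Cinf_at p f g : f = g -> f p = g p. Proof. by move=> ->. Qed.

Lemma CinfD f g p : (f + g) p = f p + g p. Proof. by []. Qed.
Lemma CinfN f p : (- f) p = - f p. Proof. by []. Qed.
Lemma CinfM f g p : (f * g) p = f p * g p. Proof. by []. Qed.
Lemma Cinf0 p : (0 : C) p = 0. Proof. by []. Qed.
Lemma Cinf1 p : (1 : C) p = 1. Proof. by []. Qed.
Lemma CcstE (c : R) p : Ccst M c p = c. Proof. by []. Qed.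
Definition CinfE := (CinfD, CinfN, CinfM, Cinf0, Cinf1, CcstE).

Lemma Cinf_sum (I : Type) (r : seq I) (F : I -> C) p :
  (\sum_(i <- r) F i) p = \sum_(i <- r) F i p.
Proof. by elim/big_ind2: _ => // ? ? ? ? <- <-. Qed.

Lemma vfP X Y : (forall f, X f = Y f) -> X = Y.
Proof. by move=> XY; apply: val_inj; apply/funext. Qed.

Lemma vfD X Y f : (X + Y) f = X f + Y f. Proof. by []. Qed.
Lemma vfZ h X f : (h *: X) f = h * X f. Proof. by []. Qed.
Lemma vf0 f : (0 : V) f = 0. Proof. by []. Qed.

Lemma vf_sum (I : Type) (r : seq I) (F : I -> V) f :
  (\sum_(i <- r) F i) f = \sum_(i <- r) F i f.
Proof. by elim/big_ind2: _ => // ? ? ? ? <- <-. Qed.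

Lemma vfM X f g : X (f * g) = f * X g + g * X f.
Proof. by have /asboolP [_ XM] := vf_derivation X; exact: XM. Qed.

Lemma vfL X c f g : X (Ccst M c * f + g) = Ccst M c * X f + X g.
Proof. by have /asboolP [XL _] := vf_derivation X; exact: XL. Qed.

Lemma vf_add X f g : X (f + g) = X f + X g.
Proof. by have := vfL X 1 f g; rewrite (_ : Ccst M 1 = 1) ?mul1r //; exact: val_inj. Qed.

Lemma vf_zero X : X 0 = 0.
Proof. by apply: (addIr (X 0)); rewrite -vf_add !add0r. Qed.

Lemma vf_scale X c f : X (Ccst M c * f) = Ccst M c * X f.
Proof. by have := vfL X c f 0; rewrite vf_zero !addr0. Qed.

Lemma vf_opp X f : X (- f) = - X f.
Proof. by apply/eqP; rewrite -addr_eq0 -vf_add addNr vf_zero. Qed.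

Lemma vf_one X : X 1 = 0.
Proof.
have := vfM X 1 1; rewrite !mul1r => E.
by apply: (addIr (X 1)); rewrite add0r -E.
Qed.

Lemma vf_cst X c : X (Ccst M c) = 0.
Proof. by rewrite -[Ccst M c]mulr1 vf_scale vf_one mulr0. Qed.

Lemma vf_bigsum X (I : Type) (r : seq I) (F : I -> C) :
  X (\sum_(i <- r) F i) = \sum_(i <- r) X (F i).
Proof.
elim: r => [|i r IH]; first by rewrite !big_nil vf_zero.
by rewrite !big_cons vf_add IH.
Qed.

Lemma Cinf_continuous f : continuous f.
Proof.
move=> p; have [c ac cp] := mfd_cover p.
have /asboolP/(_ c ac 0) [cf _] := Cinf_smooth f.
have H : {for p, continuous ((f \o chart_inv c) \o chart_map c)}.
  apply: (@continuous_comp _ _ _ (chart_map c) (f \o chart_inv c)).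
    exact: chart_map_cont.
  by apply: cf; exists p.
have E : \forall q \near p, ((f \o chart_inv c) \o chart_map c) q = f q.
  apply: (@filterS _ _ (nbhs_filter p) (chart_dom c)).
    by move=> q cq /=; rewrite chart_mapK.
  by apply: open_nbhs_nbhs; split=> //; exact: chart_dom_open.
have := @near_eq_cvg _ _ (nbhs p) (nbhs_filter p) _ _ E.
rewrite /continuous_at -[f p](_ : ((f \o chart_inv c) \o chart_map c) p = _).
  by move=> E'; apply: cvg_trans E' _; exact: H.
by rewrite /= chart_mapK.
Qed.

End Fields.

(** * Coordinate fields cut off by bumps *)

Section LocalBasis.
Variables (R : realType) (d : nat) (M : smoothManifold R d).
Notation C := (Cinf M).
Notation V := (vecfield M).
Local Notation "'ee' j" := (delta_mx ord0 j : 'rV[R]_d) (at level 10).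

Lemma smooth_onD (A : set 'rV[R]_d) f i : smooth_on A f ->
  smooth_on A (fun x => 'D_(ee i) f x).
Proof. by move=> sf k; have [_ /(_ i)[]] := sf k.+1. Qed.

Lemma smooth_on_subset (A B : set 'rV[R]_d) f : B `<=` A ->
  smooth_on A f -> smooth_on B f.
Proof. by move=> BA sf k; exact: Ck_subset (sf k). Qed.

Lemma Cinf_chart (f : C) c : mfd_atlas c -> smooth_on (chart_img c) (f \o chart_inv c).
Proof. by move=> ac; have /asboolP := Cinf_smooth f; exact. Qed.

Variables (c : chart R d M) (x : 'rV[R]_d) (r s : R).
Hypotheses (ac : mfd_atlas c) (r_gt0 : 0 < r) (rs : r < s).
Hypothesis xs : cube x s `<=` chart_img c.

Lemma chart_field (i : 'I_d) : exists E : V, forall f q,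
  (chart_dom c q -> E f q =
     cube_bump x r (chart_map c q) * 'D_(ee i) (f \o chart_inv c) (chart_map c q)) /\
  (~ chart_dom c q -> E f q = 0).
Proof.
have H (f : C) : exists F : C, 
    (forall q, chart_dom c q -> F q = cube_bump x r (chart_map c q) *
       'D_(ee i) (f \o chart_inv c) (chart_map c q)) /\
    (forall q, ~ chart_dom c q -> F q = 0).
  apply: (chart_bump_extension (u := fun y => 'D_(ee i) (f \o chart_inv c) y) ac r_gt0 rs xs).
  exact: smooth_on_subset xs (smooth_onD i (Cinf_chart f ac)).
have [E HE] := choice H.
have derf (f : C) q : chart_dom c q ->
    derivable (f \o chart_inv c) (chart_map c q) (ee i).
  move=> cq; have [_ /(_ i)[D _]] := Cinf_chart f ac 1%N.
  by apply: D; exists q.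
suff dE : (E : C -> C^o) \in @derivation R d M.
  exists (MkVecfield dE) => f q; have [H1 H2] := HE f.
  by split=> [/H1|/H2].
apply/asboolP; split=> [a f g|f g]; apply: CinfP => q; rewrite !CinfE;
  have [[f1 f0] [g1 g0]] := (HE f, HE g).
  have [h1 h0] := HE (Ccst M a * f + g).
  have [cq|ncq] := pselect (chart_dom c q); last first.
    by rewrite h0// f0// g0// mulr0 addr0.
  rewrite h1// f1// g1//.
  have -> : (Ccst M a * f + g : C) \o chart_inv c =
    (a \*: (f \o chart_inv c)) + (g \o chart_inv c) by [].
  rewrite deriveD; [|exact: derivableZ (derf _ _ cq)|exact: derf].
  by rewrite deriveZ; [rewrite /GRing.scale /=; ring|exact: derf].
have [h1 h0] := HE (f * g).
have [cq|ncq] := pselect (chart_dom c q); last first.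
  by rewrite h0// f0// g0// !mulr0 addr0.
rewrite h1// f1// g1//.
have -> : (f * g : C) \o chart_inv c = (f \o chart_inv c) * (g \o chart_inv c) by [].
rewrite deriveM; [|exact: derf..].
rewrite /GRing.scale /= chart_mapK//; ring.
Qed.

(** Fermat's theorem on the [i]-th coordinate line through the image of [p]. *)
Lemma chart_partial_at_max i (f : C) p : chart_dom c p ->
  (forall q, f q <= f p) ->
  'D_(ee i) (f \o chart_inv c) (chart_map c p) = 0.
Proof.
move=> cp fp; set y := chart_map c p; set F := f \o chart_inv c.
have yI : chart_img c y by exists p.
have y0 : y = 0 *: ee i + y by rewrite scale0r add0r.
have DF z : chart_img c z -> derivable F z (ee i).
  by move=> zI; have [_ /(_ i)[D _]] := Cinf_chart f ac 1%N; exact: D.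
have cl : {for (0:R), continuous (fun s : R => s *: ee i + y)}.
  apply: continuousD; last exact: cst_continuous.
  by apply: continuousZl; exact: cvg_id.
have [e /= e0 eI] : \forall s \near (0:R), chart_img c (s *: ee i + y).
  apply: (cl (chart_img c)); rewrite -y0.
  by apply: open_nbhs_nbhs; split => //; exact: chart_img_open.
have line (t : R) : t \in `]- e, e[ ->
    derivable (fun h : R => F (h *: ee i + y)) t 1.
  rewrite in_itv /= => te.
  have tI : chart_img c (t *: ee i + y).
    by apply: eI; rewrite /= sub0r normrN ltr_norml.
  have /is_derive_line[D _] : is_derive (t *: ee i + y) (ee i) F
      ('D_(ee i) F (t *: ee i + y)) by split=> //; exact: DF.
  exact: D.
have z0 : (0:R) \in `]- e, e[ by rewrite in_itv /= oppr_lt0 e0.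
have ee0 : - e <= e by rewrite ge0_cp// ltW.
have /is_derive_line[_ <-] : is_derive (0 *: ee i + y) (ee i) F ('D_(ee i) F y).
  by rewrite -y0; split=> //; exact: DF.
have max0 (t : R) : t \in `]- e, e[ -> F (t *: ee i + y) <= F (0 *: ee i + y).
  by move=> _; rewrite -y0 /F /= /y (chart_mapK cp); exact: fp.
by have [_ ->] := derive1_at_max ee0 line z0 max0.
Qed.

End LocalBasis.

(** * Expansion of vector fields in coordinate fields *)

Section LocalBasis.
Variables (R : realType) (d : nat) (M : smoothManifold R d).
Notation C := (Cinf M).
Notation V := (vecfield M).
Local Notation "'ee' j" := (delta_mx ord0 j : 'rV[R]_d) (at level 10).

Lemma open_chart_img (c : chart R d M) : open (chart_img c).
Proof. exact: chart_img_open. Qed.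

Lemma smooth_on_coord (A : set 'rV[R]_d) i (a : R) : open A ->
  smooth_on A (fun x => x ord0 i - a).
Proof.
by move=> oA k; exact: CkD oA (Ck_coord k i oA) (Ck_cst k (- a) oA).
Qed.

Lemma smooth_on_hadamard_quot (q : 'rV[R]_d) r f j : smooth_on (cube q r) f ->
  smooth_on (cube q r) (hadamard_quot q f j).
Proof. by move=> sf k; exact: Ck_hadamard_quot (sf k.+1). Qed.

(* [X] only acts on global functions, so the Hadamard expansion of [f] at [q] is
   multiplied by bumps before [X] is applied to it. *)
Lemma vf_apply_chart (c : chart R d M) (chi : C) (a : 'I_d -> C) (X : V) (f : C) q :
  mfd_atlas c -> chart_dom c q ->
  (forall p, ~ chart_dom c p -> chi p = 0) ->
  (forall i p, chart_dom c p -> a i p = chi p * chart_map c p ord0 i) ->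
  chi q * X f q = \sum_i (X (a i) q - chart_map c q ord0 i * X chi q) *
    'D_(ee i) (f \o chart_inv c) (chart_map c q).
Proof.
move=> ac cq chi0 aE; set y := chart_map c q; set F := f \o chart_inv c.
have yI : chart_img c y by exists q.
have [s s0 ys] := open_cubeP (@open_chart_img c) yI.
have sF : smooth_on (cube y s) F := smooth_on_subset ys (Cinf_chart f ac).
have r0 : 0 < s / 2 by rewrite divr_gt0.
have rs : s / 2 < s by rewrite ltr_pdivrMr// ltr_pMr// ltr1n.
set r := s / 2 in r0 rs.
have ext u := @chart_bump_extension _ _ _ c y r s u ac r0 rs ys.
have oc := @open_cube R d y s.
have [B [B1 B0]] := ext _ (fun k => Ck_cst k 1 oc).
have [U HU] := choice (fun i : 'I_d => ext _ (smooth_on_coord i (y ord0 i) oc)).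
have [H HH] := choice (fun i : 'I_d => ext _ (smooth_on_hadamard_quot i sF)).
(* Hadamard's expansion at [q], multiplied by the square of the bump [B]. One factor [B] is absorbed
   in [U i] and one in [H i], so that all terms are global functions. *)
have fexp : B * B * f = B * B * Ccst M (f q) + \sum_i U i * H i.
  apply: CinfP => p; rewrite !CinfE Cinf_sum.
  have [cp|ncp] := pselect (chart_dom c p); last first.
    by rewrite B0// !mul0r add0r big1// => i _; rewrite CinfE (HU i).2// mul0r.
  rewrite B1// mulr1; set b := cube_bump _ _ _.
  have -> : \sum_i (U i * H i) p = b * b * \sum_i
      (chart_map c p ord0 i - y ord0 i) * hadamard_quot y F i (chart_map c p).
    rewrite mulr_sumr; apply: eq_bigr => i _; rewrite CinfE (HU i).1// (HH i).1//.
    by rewrite -/b; ring.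
  have [b0|/eqP b0] := pselect (b = 0); first by rewrite b0 !mul0r addr0.
  have cubep : cube y s (chart_map c p).
    apply: (closed_cube_sub rs); apply: contrapT => /(cube_bump_out r0) /eqP.
    by rewrite (negbTE b0).
  rewrite -mulrDr; congr (_ * _).
  have C1 : Ck 1 (cube y s) F by exact: sF.
  have := hadamard C1 cubep.
  by rewrite /F /= !chart_mapK.
(* [U i] and [a i] are the same coordinate, up to a constant, cut off by [B] and by [chi]. This
   relation expresses [X (U i)] at [q] by [X (a i)] and [X chi]. *)
have chiU i : chi * U i = B * a i - Ccst M (y ord0 i) * (B * chi).
  apply: CinfP => p; rewrite !CinfE.
  have [cp|ncp] := pselect (chart_dom c p); last first.
    by rewrite B0// (HU i).2// !mul0r !mulr0 subr0.
  by rewrite B1// (HU i).1// aE//; ring.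
have Bq : B q != 0 by rewrite B1// mulr1; exact: cube_bump_center.
have Uq i : U i q = 0 by rewrite (HU i).1// subrr mulr0.
have Hq i : H i q = B q * 'D_(ee i) F y.
  by rewrite (HH i).1// B1// mulr1 hadamard_quot_center.
have XUq i : chi q * X (U i) q = B q * (X (a i) q - y ord0 i * X chi q).
  have := Cinf_at q (congr1 X (chiU i)).
  rewrite vf_add vf_opp vf_scale !vfM !CinfE Uq mul0r addr0 aE// -/y => ->.
  by ring.
have := Cinf_at q (congr1 X fexp).
rewrite vf_add !vfM vf_cst vf_bigsum !CinfE mulr0 add0r Cinf_sum.
under [in X in _ = X -> _]eq_bigr do rewrite vfM !CinfE Uq mul0r add0r Hq.
move=> E.
(* The derivative of [B * B] contributes the same multiple of [f q] to both sides and cancels. *)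
have E' : \sum_i B q * 'D_(ee i) F y * X (U i) q = B q * B q * X f q.
  by apply/esym/(addIr (f q * (B q * X B q + B q * X B q))); rewrite E addrC.
apply: (mulfI Bq); apply: (mulfI Bq).
transitivity (chi q * (B q * B q * X f q)); first by ring.
rewrite -E' !mulr_sumr; apply: eq_bigr => i _.
transitivity (B q * 'D_(ee i) F y * (chi q * X (U i) q)); first by ring.
by rewrite XUq; ring.
Qed.

Lemma chart_bump (p : M) : exists (c : chart R d M) (r s : R) (chi : C) (a : 'I_d -> C),
  [/\ mfd_atlas c /\ chart_dom c p, 0 < r < s, cube (chart_map c p) s `<=` chart_img c,
    (forall q, chart_dom c q -> chi q = cube_bump (chart_map c p) r (chart_map c q)) /\
    (forall q, ~ chart_dom c q -> chi q = 0) &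
    forall i q, chart_dom c q -> a i q = chi q * chart_map c q ord0 i].
Proof.
have [c ac cp] := mfd_cover p; set y := chart_map c p.
have yI : chart_img c y by exists p.
have [s s0 ys] := open_cubeP (@open_chart_img c) yI.
have r0 : 0 < s / 2 by rewrite divr_gt0.
have rs : s / 2 < s by rewrite ltr_pdivrMr// ltr_pMr// ltr1n.
set r := s / 2 in r0 rs.
have ext u := @chart_bump_extension _ _ _ c y r s u ac r0 rs ys.
have oc := @open_cube R d y s.
have [B [B1 B0]] := ext _ (fun k => Ck_cst k 1 oc).
have [U HU] := choice (fun i : 'I_d => ext _ (smooth_on_coord i 0 oc)).
exists c, r, s, B, U; split=> //; first by rewrite r0.
- by split=> // q cq; rewrite B1// mulr1.
- by move=> i q cq; rewrite (HU i).1// B1// mulr1 subr0.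
Qed.

Lemma vf_at_max (X : V) (f : C) p : (forall q, f q <= f p) -> X f p = 0.
Proof.
move=> fp; have [c [r [s [chi [a [[ac cp] /andP[r0 rs] ys [chi1 chi0] aE]]]]]] := chart_bump p.
have chip : chi p != 0 by rewrite chi1//; exact: cube_bump_center.
apply: (mulfI chip); rewrite mulr0 (vf_apply_chart X f ac cp chi0 aE).
by rewrite big1// => i _; rewrite (chart_partial_at_max ac i cp fp) mulr0.
Qed.

(** A basis of fields near [p], stated globally: the bump factor [b] absorbs the cut-offs. The last
    clause says that the coefficients at [p] depend only on the tangent vector at [p]. *)
Lemma local_basis (p : M) : exists (b : C) (E : 'I_d -> V) (al : 'I_d -> V -> C),
  [/\ b p != 0, forall i h X Y, al i (h *: X + Y) = h * al i X + al i Y,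
      forall X, b *: X = \sum_i al i X *: E i,
      forall i j, al i (E j) p = (i == j)%:R * b p &
      forall X : V, (forall f, X f p = 0) -> forall i, al i X p = 0].
Proof.
have [c [r [s [chi [a [[ac cp] /andP[r0 rs] ys [chi1 chi0] aE]]]]]] := chart_bump p.
set y := chart_map c p in ys chi1.
have [E HE] := choice (fun i : 'I_d => chart_field ac r0 rs ys i).
(* Since [a i] is [chi] times the [i]-th coordinate, the coefficient is [chi^2] times the derivative
   of that coordinate along [X]. The third factor [chi] of [b] is the bump contained in [E i]. *)
exists (chi * chi * chi), E, (fun i X => chi * X (a i) - a i * X chi).
have chip : chi p != 0 by rewrite chi1//; exact: cube_bump_center.
split.
- by rewrite !CinfE !mulf_neq0.
- move=> i h X Y; rewrite !vfD !vfZ; apply: CinfP => q; rewrite !CinfE; ring.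
- move=> X; apply: vfP => f; rewrite vfZ vf_sum; apply: CinfP => q.
  rewrite !CinfE Cinf_sum.
  have [cq|ncq] := pselect (chart_dom c q); last first.
    by rewrite chi0// !mul0r big1// => i _; rewrite vfZ CinfE (HE i f q).2// mulr0.
  transitivity (chi q * chi q * (chi q * X f q)); first by ring.
  rewrite (vf_apply_chart X f ac cq chi0 aE) mulr_sumr.
  apply: eq_bigr => i _; rewrite vfZ !CinfE (HE i f q).1// aE// -chi1//.
  by ring.
- move=> i j; rewrite !CinfE aE// (HE j _ p).1// (HE j _ p).1// -chi1//.
  have -> : 'D_(ee j) (a i \o chart_inv c) y =
      chi p * (i == j)%:R + y ord0 i * 'D_(ee j) (chi \o chart_inv c) y.
    have oI := @open_chart_img c.
    have yI : chart_img c y by exists p.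
    have Dchi : derivable (chi \o chart_inv c) y (ee j).
      by have [_ /(_ j)[D _]] := Cinf_chart chi ac 1%N; exact: D.
    have [Dy Dyv] := is_derive_coord y (ee j) i.
    transitivity ('D_(ee j) ((chi \o chart_inv c) * (fun z : 'rV[R]_d => z ord0 i)) y).
      apply: near_eq_derive; apply: (@filterS _ _ (nbhs_filter y) (chart_img c)).
        by move=> _ [q cq <-] /=; rewrite fctE /= chart_mapK// aE.
      exact: open_nbhs_nbhs.
    rewrite deriveM// Dyv /GRing.scale /= chart_mapK// mxE eqxx /=.
    by [].
  by rewrite -/y; ring.
- by move=> X X0 i; rewrite !CinfE !X0 !mulr0 subr0.
Qed.

End LocalBasis.

(** * Orthonormal frames *)

(** Gram-Schmidt on the number [k] of rows. As long as [k < d], the matrix [G *m P^T] has too few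
    columns to have full row rank, and a normalised vector of its left kernel is the next row. *)
Lemma posdef_orthonormal (R : rcfType) (d : nat) (G : 'M[R]_d) : G^T = G ->
  (forall v : 'rV[R]_d, v != 0 -> 0 < (v *m G *m v^T) 0 0) ->
  exists P : 'M[R]_d, P *m G *m P^T = 1%:M.
Proof.
move=> symG posG.
suff H k : (k <= d)%N -> exists P : 'M[R]_(k, d), P *m G *m P^T = 1%:M by exact: H.
elim: k => [_|k IH kd]; first by exists 0; apply/matrixP => -[].
have [P PGP] := IH (ltnW kd).
pose A := G *m P^T.
have : kermx A != 0.
  rewrite -mxrank_eq0 mxrank_ker subn_eq0 -ltnNge.
  by apply: leq_ltn_trans kd; exact: rank_leq_col.
case/rowV0Pn => v /sub_kermxP vA vn0.
have vGP : v *m G *m P^T = 0 by rewrite -mulmxA.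
have := posG _ vn0; set n2 := (_ 0 0) => n2_gt0.
pose n := Num.sqrt n2.
have n_gt0 : 0 < n by rewrite sqrtr_gt0.
have nn : n * n = n2 by rewrite -expr2 sqr_sqrtr// ltW.
pose w := n^-1 *: v.
have wGP : w *m G *m P^T = 0 by rewrite -!scalemxAl vGP scaler0.
have wGw : w *m G *m w^T = 1%:M.
  rewrite -!scalemxAl linearZ /= -scalemxAr scalerA.
  rewrite [v *m G *m v^T]mx11_scalar -/n2 -nn scale_scalar_mx.
  by congr (_%:M); field; rewrite gt_eqF.
have PGw : P *m G *m w^T = 0.
  by apply: (can_inj (@trmxK _ _ _)); rewrite !trmx_mul trmxK symG mulmxA wGP trmx0.
suff H : col_mx w P *m G *m (col_mx w P)^T = 1%:M :> 'M[R]_(1 + k).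
  by exists (col_mx w P).
rewrite (tr_col_mx w P) !mul_col_mx !mul_mx_row wGw wGP PGw PGP.
by rewrite [RHS]scalar_mx_block.
Qed.

Section Frames.
Variables (R : realType) (d : nat) (M : smoothManifold R d) (g : metric M).
Notation C := (Cinf M).
Notation V := (vecfield M).
Implicit Types (X Y Z : V) (f h : C) (p : M).

Lemma metricDl X Y Z : g (X + Y) Z = g X Z + g Y Z.
Proof. by have := metric_linear g 1 X Y Z; rewrite scale1r mul1r. Qed.

Lemma metric0l Z : g 0 Z = 0.
Proof. by apply: (addIr (g 0 Z)); rewrite -metricDl !add0r. Qed.

Lemma metricZl f X Z : g (f *: X) Z = f * g X Z.
Proof. by have := metric_linear g f X 0 Z; rewrite metric0l !addr0. Qed.

Lemma metricNl X Z : g (- X) Z = - g X Z.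
Proof. by apply/eqP; rewrite -addr_eq0 -metricDl addNr metric0l. Qed.

Lemma metricC X Y : g X Y = g Y X. Proof. exact: Defs.metric_sym. Qed.
Lemma metricDr X Y Z : g Z (X + Y) = g Z X + g Z Y.
Proof. by rewrite metricC metricDl !(metricC Z). Qed.
Lemma metricZr f X Z : g Z (f *: X) = f * g Z X.
Proof. by rewrite metricC metricZl (metricC Z). Qed.
Lemma metricNr X Z : g Z (- X) = - g Z X.
Proof. by rewrite metricC metricNl (metricC Z). Qed.
Lemma metric0r Z : g Z 0 = 0. Proof. by rewrite metricC metric0l. Qed.

Lemma metric_suml (I : Type) (r : seq I) (F : I -> V) Z :
  g (\sum_(i <- r) F i) Z = \sum_(i <- r) g (F i) Z.
Proof. by elim: r => [|i r IH]; rewrite ?big_nil ?metric0l// !big_cons metricDl IH. Qed.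

Lemma metric_sumr (I : Type) (r : seq I) (F : I -> V) Z :
  g Z (\sum_(i <- r) F i) = \sum_(i <- r) g Z (F i).
Proof. by rewrite metricC metric_suml; apply: eq_bigr => i _; rewrite metricC. Qed.

Lemma metric_nondeg X : (forall Z, g X Z = 0) -> X = 0.
Proof.
move=> X0; apply: vfP => f; apply: CinfP => p; apply: contrapT => Xfp.
have := @metric_pos _ _ _ g X p; rewrite X0 => /(_ _)/wrap[]; last by rewrite ltxx.
by exists f; apply/eqP.
Qed.

Lemma metric_inj X Y : (forall Z, g X Z = g Y Z) -> X = Y.
Proof.
move=> XY; apply/eqP; rewrite -subr_eq0; apply/eqP; apply: metric_nondeg => Z.
by rewrite metricDl metricNl XY subrr.
Qed.

(** The metric at [p] becomes a Gram matrix in the basis of [local_basis]. Coordinates are divided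
    by [b p], so [g X Y p] is recovered after cancelling [b p] twice. *)
Lemma metric_coords p : exists (E : 'I_d -> V) (x : V -> 'rV[R]_d) (G : 'M[R]_d),
  [/\ G^T = G, forall v : 'rV[R]_d, v != 0 -> 0 < (v *m G *m v^T) 0 0,
      forall v : 'rV[R]_d, x (\sum_i Ccst M (v ord0 i) *: E i) = v &
      forall X Y, g X Y p = (x X *m G *m (x Y)^T) 0 0].
Proof.
have [b [E [al [bp alL bX alE al0]]]] := local_basis p.
pose x X := \row_i ((b p)^-1 * al i X p).
pose G : 'M[R]_d := \matrix_(i, j) g (E i) (E j) p.
have xE (v : 'rV[R]_d) : x (\sum_i Ccst M (v ord0 i) *: E i) = v.
  apply/rowP => i; rewrite mxE.
  have al0' : al i 0 = 0.
    have := alL i 1 0 0; rewrite scale1r mul1r addr0 => E0.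
    by apply: (addIr (al i 0)); rewrite add0r -E0.
  have alS (r : seq 'I_d) (F : 'I_d -> V) (c : 'I_d -> C) :
      al i (\sum_(j <- r) c j *: F j) = \sum_(j <- r) c j * al i (F j).
    elim: r => [|j r IH]; first by rewrite !big_nil.
    by rewrite !big_cons alL IH.
  rewrite alS Cinf_sum (bigD1 i)// big1 ?addr0; last first.
    by move=> j ji; rewrite !CinfE alE eq_sym (negbTE ji) mul0r mulr0.
  by rewrite !CinfE alE eqxx /= addr0 mul1r mulrCA mulVf// mulr1.
have coordE X Y : g X Y p = (x X *m G *m (x Y)^T) 0 0.
  apply: (mulfI bp); apply: (mulfI bp).
  transitivity (g (b *: X) (b *: Y) p); first by rewrite metricZl metricZr !CinfE; ring.
  rewrite !bX metric_suml Cinf_sum mxE !mulr_sumr.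
  under [RHS]eq_bigr do rewrite mxE mulr_suml !mulr_sumr.
  rewrite [RHS]exchange_big /=; apply: eq_bigr => i _.
  rewrite metricZl CinfE metric_sumr Cinf_sum mulr_sumr; apply: eq_bigr => j _.
  by rewrite metricZr CinfE !mxE; field.
exists E, x, G; split=> //; first by apply/matrixP => i j; rewrite !mxE metricC.
move=> v vn0; rewrite -[v]xE -coordE; apply: metric_pos; apply: contrapT => X0.
suff : v = 0 by move/eqP: vn0.
rewrite -[v]xE; apply/rowP => i; rewrite mxE al0 ?mulr0 ?mxE// => f.
by apply/eqP/negPn/negP => H; apply: X0; exists f.
Qed.

(** An orthonormal frame exists at [p], so the choice in [frame_at] never falls back on its default
    value. *)
Lemma orthonormal_frame p : orthonormal_at g p (frame_at g p).
Proof.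
have [E [x [G [symG posG xE coordE]]]] := metric_coords p.
have [P PGP] := posdef_orthonormal symG posG.
suff : exists e, orthonormal_at g p e.
  by move=> ex; exact: (@xgetPex _ (fun=> 0) [set e | orthonormal_at g p e] ex).
exists (fun i => \sum_j Ccst M (row i P ord0 j) *: E j) => i j.
rewrite coordE !xE; have /matrixP/(_ i j) := PGP; rewrite [in X in _ = X -> _]mxE => <-.
by rewrite -row_mul tr_row !mxE; apply: eq_bigr => k _; rewrite !mxE.
Qed.

(** For the square matrix [P] of the frame, [P G P^T = 1] implies [P^T P G = 1]. Later traces are
    computed by inserting this identity. *)
Lemma parseval p X Y : \sum_i g X (frame_at g p i) p * g Y (frame_at g p i) p = g X Y p.
Proof.
have [E [x [G [symG posG xE coordE]]]] := metric_coords p.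
set e := frame_at g p; have oe : orthonormal_at g p e := orthonormal_frame p.
pose P := \matrix_i x (e i).
have PGP : P *m G *m P^T = 1%:M.
  apply/matrixP => i j; rewrite [RHS]mxE -oe coordE.
  rewrite -[x (e i)](rowK (fun i => x (e i))) -[x (e j)](rowK (fun i => x (e i))).
  rewrite -/P -row_mul tr_row !mxE; apply: eq_bigr => k _; rewrite !mxE//.
have PGP' : P^T *m (P *m G) = 1%:M by apply: mulmx1C.
have gP Z i : g Z (e i) p = (x Z *m G *m P^T) 0 i.
  rewrite coordE -[x (e i)](rowK (fun i => x (e i))) -/P tr_row.
  rewrite [LHS]mxE [RHS]mxE; apply: eq_bigr => k _; congr (_ * _).
  by rewrite [LHS]mxE.
transitivity (((x X *m G *m P^T) *m (x Y *m G *m P^T)^T) 0 0).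
  by rewrite [RHS]mxE; apply: eq_bigr => i _; rewrite !gP; congr (_ * _); rewrite [RHS]mxE.
rewrite coordE !trmx_mul trmxK symG; congr (_ 0 0).
rewrite !mulmxA; suff -> : x X *m G *m P^T *m P *m G = x X *m G by [].
by rewrite -!mulmxA PGP' mulmx1.
Qed.

End Frames.

(* [ring] does not find the ring structure when the equality is at type [Cinf M]. *)
Ltac cring := lazymatch goal with
  | |- @eq (@Cinf ?R ?d ?M) ?a ?b => change (@eq (@Cinf R d M : comPzRingType) a b)
  | |- _ => idtac
  end; ring.

(** Proves an equation as a multiple of a known one, leaving a ring identity. *)
Lemma eq_lin (K : comPzRingType) (x y a b c : K) :
  a = b -> x - y = c * (a - b) -> x = y.
Proof. by move=> ->; rewrite subrr mulr0 => /eqP; rewrite subr_eq0 => /eqP. Qed.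

(** * The Levi-Civita connection and the symmetries of its curvature *)

Section Connection.
Variables (R : realType) (d : nat) (M : smoothManifold R d).
Variables (g : metric M) (nabla : connection M).
Notation C := (Cinf M).
Notation V := (vecfield M).
Implicit Types (E F G H X Y Z : V) (f : C).

Lemma nablaDl E F X : nabla (E + F) X = nabla E X + nabla F X.
Proof. by have := conn_linear nabla 1 E F X; rewrite !scale1r. Qed.

Lemma nabla0l X : nabla 0 X = 0.
Proof. by apply: (addIr (nabla 0 X)); rewrite -nablaDl !add0r. Qed.

Lemma nablaZl f E X : nabla (f *: E) X = f *: nabla E X.
Proof. by have := conn_linear nabla f E 0 X; rewrite nabla0l !addr0. Qed.

Lemma nablaNl E X : nabla (- E) X = - nabla E X.
Proof. by apply/eqP; rewrite -addr_eq0 -nablaDl addNr nabla0l. Qed.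

Lemma nablaD E X Y : nabla E (X + Y) = nabla E X + nabla E Y.
Proof. exact: conn_additive. Qed.

Lemma nabla0 E : nabla E 0 = 0.
Proof. by apply: (addIr (nabla E 0)); rewrite -nablaD !add0r. Qed.

Lemma nablaN E X : nabla E (- X) = - nabla E X.
Proof. by apply/eqP; rewrite -addr_eq0 -nablaD addNr nabla0. Qed.

Lemma nablaZ E f X : nabla E (f *: X) = E f *: X + f *: nabla E X.
Proof. exact: conn_leibniz. Qed.

Lemma nablaCZ E c X : nabla E (Ccst M c *: X) = Ccst M c *: nabla E X.
Proof. by rewrite nablaZ vf_cst scale0r add0r. Qed.

Definition metricE := (metricDl g, metricNl g, metricZl g,
  metricDr g, metricNr g, metricZr g, metric0l g, metric0r g).

Lemma bracketE E F f : bracket E F f = E (F f) - F (E f).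
Proof. by []. Qed.

Lemma bracketC E F : bracket F E = - bracket E F.
Proof. by apply: vfP => f; rewrite bracketE -[RHS]/(- (E (F f) - F (E f))) opprB. Qed.

Hypothesis LC : levi_civita g nabla.

Lemma torsion_free E F : bracket E F = nabla E F - nabla F E.
Proof. by have [-> _] := LC. Qed.

Lemma nabla_metric X E F : X (g E F) = g (nabla X E) F + g E (nabla X F).
Proof. by have [_ ->] := LC. Qed.

Lemma jacobi E F G :
  bracket E (bracket F G) + bracket F (bracket G E) + bracket G (bracket E F) = 0.
Proof.
apply: vfP => f; rewrite !vfD !bracketE !vf_add !vf_opp vf0; cring.
Qed.

Lemma curvatureC E F G : curvature nabla F E G = - curvature nabla E F G.
Proof.
by rewrite /curvature (bracketC E F) nablaNl !opprD !opprK; congr (_ + _); rewrite addrC.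
Qed.

(** Without torsion, the Jacobi identity expands into exactly this cyclic sum. *)
Lemma curvature_bianchi E F G :
  curvature nabla E F G + curvature nabla F G E + curvature nabla G E F = 0.
Proof.
apply: (metric_inj (g := g)) => Z.
have /(congr1 (fun X => g X Z)) := jacobi E F G.
have nB X Y Z' : nabla X (bracket Y Z') = nabla X (nabla Y Z') - nabla X (nabla Z' Y).
  by rewrite torsion_free nablaD nablaN.
rewrite (torsion_free E (bracket F G)) (torsion_free F (bracket G E))
  (torsion_free G (bracket E F)) !nB /curvature !metricE => J.
by rewrite -[RHS]J; cring.
Qed.

(** Both sides of [[E, F] = E F - F E] are applied to [g G H]; the mixed products of first
    derivatives cancel. *)
Lemma curvature_metric E F G H :
  g (curvature nabla E F G) H = - g (curvature nabla E F H) G.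
Proof.
have := bracketE E F (g G H).
rewrite !nabla_metric !vf_add !nabla_metric => J.
rewrite /curvature !metricE (metricC g (nabla E _) G) (metricC g (nabla F (nabla E H)) G)
  (metricC g (nabla (bracket E F) H) G).
by apply: (eq_lin (c := -1) J); cring.
Qed.

End Connection.

(** * (kappa, mu)-almost co-Kaehler manifolds *)

Section AlmostContact.
Variables (R : realType) (d : nat) (M : smoothManifold R d).
Variables (S : almost_contact_metric M) (nabla : connection M).
Notation C := (Cinf M).
Notation V := (vecfield M).
Implicit Types (E F G H X Y Z : V) (f : C).

Local Notation g := (acm_metric S).
Local Notation phi := (acm_phi S).
Local Notation zeta := (acm_zeta S).
Local Notation ginj := (metric_inj (g := acm_metric S)).

(** * Algebra of an almost contact metric structure *)

Lemma phiD X Y : phi (X + Y) = phi X + phi Y. Proof. exact: linearD. Qed.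
Lemma phiN X : phi (- X) = - phi X. Proof. exact: linearN. Qed.
Lemma phi0 : phi 0 = 0. Proof. exact: linear0. Qed.
Lemma phiZ f X : phi (f *: X) = f *: phi X. Proof. exact: linearZ. Qed.

Lemma etaZ f X : acm_eta S (f *: X) = f * acm_eta S X :> C.
Proof. have := linearZ_LR (acm_eta S) f X; exact. Qed.

Lemma CM_eq0 f : f * f = 0 -> f = 0.
Proof.
move=> f0; apply: CinfP => p; have := Cinf_at p f0.
by rewrite CinfE => /eqP; rewrite mulf_eq0 orbb => /eqP.
Qed.

(** From [phi (phi zeta) = 0] one gets [phi zeta = a zeta], then [a^2 = 0], and smooth functions
    have no nilpotents. *)
Lemma phi_zeta : phi zeta = 0.
Proof.
have p2 : phi (phi zeta) = 0.
  by rewrite acm_phi2 acm_eta_zeta scale1r addNr.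
have := acm_phi2 S (phi zeta); rewrite p2 phi0 => /eqP.
rewrite eq_sym addrC subr_eq0 => /eqP; set a : C := acm_eta S (phi zeta) => pz.
have a0 : a = 0.
  apply: CM_eq0; have := p2; rewrite -{1}pz phiZ -pz scalerA => /(congr1 (acm_eta S)).
  by rewrite linear0 etaZ acm_eta_zeta mulr1.
by rewrite -pz a0 scale0r.
Qed.

Lemma etaE E : acm_eta S E = g E zeta :> C.
Proof.
have := acm_compat S E zeta; rewrite phi_zeta metric0r acm_eta_zeta mulr1 => /esym/eqP.
by rewrite subr_eq0 => /eqP.
Qed.

Lemma g_zeta : g zeta zeta = 1.
Proof. by rewrite -etaE acm_eta_zeta. Qed.

Lemma phi2 E : phi (phi E) = - E + g E zeta *: zeta.
Proof. by rewrite acm_phi2 etaE. Qed.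

Lemma phi_compat E F : g (phi E) (phi F) = g E F - g E zeta * g F zeta.
Proof. by rewrite acm_compat !etaE. Qed.

(** Compare the two ways of computing the cube of [phi]. *)
Lemma g_phi_zeta E : g (phi E) zeta = 0.
Proof.
have := congr1 phi (phi2 E); rewrite phi2 phiD phiN phiZ phi_zeta scaler0 addr0.
move/eqP; rewrite -[X in _ == X]addr0 (inj_eq (addrI _)) => /eqP/(congr1 (g^~ zeta)).
by rewrite metricZl g_zeta mulr1 metric0l.
Qed.

Lemma phi_skew E F : g (phi E) F = - g E (phi F).
Proof.
have := phi_compat E (phi F); rewrite phi2 !metricE !g_phi_zeta => H.
by apply: (eq_lin (c := -1) H); cring.
Qed.

Lemma g_zeta_phi E : g zeta (phi E) = 0.
Proof. by rewrite metricC g_phi_zeta. Qed.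

(** * Consequences of the closedness of [eta] and [Phi] *)

Hypothesis LC : levi_civita g nabla.
Hypothesis deta : forall E F, d1 (acm_eta S) E F = 0.
Hypothesis dPhi : forall E F G, d2 (fundamental_form S) E F G = 0.

(* Up to sign, the shape operator of the leaves of [ker eta]. *)
Definition shape E : V := nabla E zeta.
Local Notation T := shape.

Lemma shapeD E F : T (E + F) = T E + T F. Proof. exact: nablaDl. Qed.
Lemma shapeN E : T (- E) = - T E. Proof. exact: nablaNl. Qed.
Lemma shapeZ f E : T (f *: E) = f *: T E. Proof. exact: nablaZl. Qed.

Lemma g_shape_zeta E : g (T E) zeta = 0.
Proof.
have := nabla_metric LC E zeta zeta; rewrite g_zeta vf_one (metricC g zeta) => H.
apply: CinfP => p; have := Cinf_at p H.
by rewrite !CinfE /shape => ?; lra.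
Qed.

Lemma g_nabla_zeta E F : g (nabla E F) zeta = E (g F zeta) - g F (T E).
Proof. by rewrite (nabla_metric LC) /shape; cring. Qed.

Lemma shape_sym E F : g (T E) F = g E (T F).
Proof.
have := deta E F; rewrite /d1 !etaE (torsion_free LC) !metricE !g_nabla_zeta => H.
rewrite (metricC g (T E)).
by apply: (eq_lin (c := 1) H); cring.
Qed.

Lemma shape_zeta : T zeta = 0.
Proof. by apply: (@metric_nondeg _ _ _ g) => Z; rewrite shape_sym metricC g_shape_zeta. Qed.

Lemma g_bracket_zeta E F : g E zeta = 0 -> g F zeta = 0 -> g (bracket E F) zeta = 0.
Proof.
move=> E0 F0; rewrite (torsion_free LC) !metricE !g_nabla_zeta E0 F0 !vf_zero.
by rewrite -shape_sym (metricC g (T F)); cring.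
Qed.

Definition nabla_phi E F : V := nabla E (phi F) - phi (nabla E F).

(** Covariant derivative of the identity [phi^2 = - I + eta (x) zeta]. *)
Lemma nabla_phi_phi E F : nabla_phi E (phi F) + phi (nabla_phi E F) =
  g (T E) F *: zeta + g F zeta *: T E.
Proof.
rewrite /nabla_phi phiD phiN addrA subrK !phi2 nablaD nablaN nablaZ g_nabla_zeta -/(T E).
by apply: ginj => Z; rewrite !metricE (metricC g F (T E)); cring.
Qed.

Lemma nabla_phi_zeta F : nabla_phi zeta F = - (phi (T F) + T (phi F)).
Proof.
apply: ginj => E; have := dPhi zeta E F.
rewrite /d2 /fundamental_form !g_zeta_phi phi_zeta !metric0r !vf_zero.
rewrite !(torsion_free LC) (nabla_metric LC) !metricE -!/(T _) => H.
rewrite !phi_skew (shape_sym (phi F)) (metricC g (phi F)) (metricC g (nabla zeta (phi F))).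
by apply: (eq_lin (c := 1) H); cring.
Qed.

(** Because [T zeta = 0], [nabla_phi_phi] along [zeta] says that [nabla_phi zeta] anticommutes with
    [phi]. Inserting [nabla_phi_zeta] gives twice the claim. *)
Lemma shape_conj F : T F = phi (T (phi F)).
Proof.
have := nabla_phi_phi zeta F; rewrite shape_zeta metric0l scale0r scaler0 addr0 !nabla_phi_zeta.
rewrite phiN phiD phi2 phi2 shapeD shapeN shapeZ shape_zeta scaler0 addr0.
rewrite g_shape_zeta scale0r addr0.
move=> /(congr1 (fun X => Ccst M 2^-1 *: X)); rewrite scaler0 => H.
apply: ginj => Z; have /(congr1 (fun X => g X Z)) := H; rewrite !metricE => {}H.
apply: CinfP => p; have := Cinf_at p H; rewrite !CinfE => {}H.
by lra.
Qed.

Lemma phi_shape F : phi (T F) = - T (phi F).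
Proof. by rewrite shape_conj phi2 g_shape_zeta scale0r addr0. Qed.

Lemma shape_phi F : T (phi F) = - phi (T F).
Proof. by rewrite phi_shape opprK. Qed.

Lemma nabla_phi_zeta0 F : nabla_phi zeta F = 0.
Proof. by rewrite nabla_phi_zeta phi_shape addNr oppr0. Qed.

Lemma nabla_zeta_phi F : nabla zeta (phi F) = phi (nabla zeta F).
Proof. by apply/eqP; rewrite -subr_eq0; apply/eqP; exact: nabla_phi_zeta0. Qed.

Lemma acm_hE E : acm_h S E = phi (T E).
Proof.
rewrite /acm_h /lie_derivative11 !(torsion_free LC) nabla_zeta_phi phiD phiN.
rewrite -!/(T _) phi_shape.
apply: ginj => Z; rewrite !metricE.
by apply: CinfP => p; rewrite !CinfE; field.
Qed.

Lemma phi_zeta_perp E : g E zeta = 0 -> phi (phi E) = - E.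
Proof. by move=> E0; rewrite phi2 E0 scale0r addr0. Qed.

(** * The (kappa, mu) condition and the square of the shape operator *)

Variables (kappa mu : R).
Hypothesis kappa0 : kappa < 0.
Hypothesis KM : forall E F, curvature nabla E F zeta =
    Ccst M kappa *: ((acm_eta S F : C) *: E - (acm_eta S E : C) *: F) +
    Ccst M mu *: ((acm_eta S F : C) *: acm_h S E - (acm_eta S E : C) *: acm_h S F).

Lemma curv_zeta E F : curvature nabla E F zeta =
    Ccst M kappa *: (g F zeta *: E - g E zeta *: F) +
    Ccst M mu *: (g F zeta *: phi (T E) - g E zeta *: phi (T F)).
Proof. by rewrite KM !etaE !acm_hE. Qed.

(** The Riccati equation of [T] along the integral curves of [zeta], from the value of
    [K(E, zeta) zeta]. *)
Lemma nabla_zeta_shape E : nabla zeta (T E) - T (nabla zeta E) =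
  - T (T E) - Ccst M kappa *: (E - g E zeta *: zeta) - Ccst M mu *: phi (T E).
Proof.
have := curv_zeta E zeta; rewrite g_zeta shape_zeta phi0 scaler0 subr0 !scale1r.
rewrite /curvature -!/(T _) shape_zeta nabla0 (torsion_free LC) shapeD shapeN => H.
apply: ginj => Z; have /(congr1 (fun X => g X Z)) := H; rewrite !metricE => {}H.
by apply: (eq_lin (c := -1) H); cring.
Qed.

(** In the Riccati equation the left side and the [mu] term anticommute with [phi], whereas [T^2]
    and the [kappa] term commute with it. The commuting part therefore vanishes. *)
Lemma shape_shape E : T (T E) = - (Ccst M kappa *: (E - g E zeta *: zeta)).
Proof.
have H : nabla zeta (T (phi E)) - T (nabla zeta (phi E)) =
    - phi (nabla zeta (T E) - T (nabla zeta E)).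
  by rewrite nabla_zeta_phi !shape_phi nablaN nabla_zeta_phi phiD phiN opprD.
move: H; rewrite !nabla_zeta_shape g_phi_zeta scale0r subr0 -shape_conj.
rewrite !shape_phi shapeN shape_phi opprK.
rewrite !(phiD, phiN, phiZ) phi_zeta scaler0 subr0 phi2 g_shape_zeta scale0r addr0 => H.
have {}H : phi (T (T E)) = - (Ccst M kappa *: phi E).
  apply: ginj => Z; have /(congr1 (fun X => g X Z)) := H; rewrite !metricE => {}H.
  apply: CinfP => p; have := Cinf_at p H; rewrite !CinfE => {}H.
  by lra.
have := congr1 phi H; rewrite phiN phiZ !phi2 g_shape_zeta scale0r addr0 => {}H.
by rewrite -[LHS]opprK H opprK -scalerN opprB addrC.
Qed.

Lemma shape_shape_perp E : g E zeta = 0 -> T (T E) = - (Ccst M kappa *: E).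
Proof. by move=> E0; rewrite shape_shape E0 scale0r subr0. Qed.

Notation perp E := (g E zeta = 0).

Lemma curv_zeta_perp E F : perp E -> perp F -> curvature nabla E F zeta = 0.
Proof. by move=> E0 F0; rewrite curv_zeta E0 F0 !scale0r !subrr !scaler0 addr0. Qed.

(** * The shape operator is parallel along the leaves *)

Definition dshape E F G : C := g (nabla E (T F) - T (nabla E F)) G.

Lemma dshape_sym23 E F G : dshape E F G = dshape E G F.
Proof.
have := nabla_metric LC E (T F) G; rewrite {1}shape_sym (nabla_metric LC).
rewrite (metricC g (T F)) (metricC g F) => H.
rewrite /dshape !metricE (shape_sym (nabla E F)) (shape_sym (nabla E G)).
by apply: (eq_lin (c := -1) H); cring.
Qed.

(** [K(E, F) zeta] is the skew part of the derivative of [T], and it vanishes on [ker eta]. *)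
Lemma dshape_codazzi E F G : perp E -> perp F -> dshape E F G = dshape F E G.
Proof.
move=> E0 F0; have := curv_zeta_perp E0 F0.
rewrite /curvature -!/(T _) (torsion_free LC) shapeD shapeN => /(congr1 (g^~ G)).
rewrite /dshape !metricE => H.
by apply: (eq_lin (c := 1) H); cring.
Qed.

Lemma dshape_shape E F G : perp F -> perp G -> dshape E (T F) G = - dshape E F (T G).
Proof.
move=> F0 G0; rewrite /dshape (shape_shape_perp F0) nablaN nablaCZ !metricE.
rewrite -!shape_sym shape_shape !metricE.
by rewrite (metricC g zeta) G0; cring.
Qed.

(** On [ker eta] the tensor [dshape] is totally symmetric, and moving [T] between any two slots
    changes the sign. With three slots this forces the tensor with one [T] inserted to vanish, and
    [T] is invertible on [ker eta] as [kappa] is nonzero. *)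
Lemma dshape0 E F G : perp E -> perp F -> perp G -> dshape E F G = 0.
Proof.
have T0 E' F' G' : perp E' -> perp F' -> perp G' -> dshape (T E') F' G' = 0.
  move=> E0 F0 G0.
  have h1 : dshape (T E') F' G' = - dshape E' F' (T G').
    rewrite dshape_codazzi ?g_shape_zeta// dshape_shape//.
    by rewrite dshape_codazzi.
  have h2 : dshape E' (T F') G' = - dshape E' F' (T G') by exact: dshape_shape.
  have h3 : dshape (T E') F' G' = - dshape E' (T F') G'.
    by rewrite dshape_sym23 dshape_codazzi ?g_shape_zeta// dshape_shape//
      dshape_codazzi// (dshape_sym23 E' G').
  apply: CinfP => p; move: h1 h2 h3 => /(Cinf_at p) h1
    /(Cinf_at p) h2 /(Cinf_at p) h3.
  by move: h1 h2 h3; rewrite !CinfE => *; lra.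
move=> E0 F0 G0; have := T0 (T E) F G (g_shape_zeta _) F0 G0.
rewrite (shape_shape_perp E0) /dshape !nablaNl !nablaZl shapeN shapeZ !metricE => H.
apply: CinfP => p; have := Cinf_at p H; rewrite !CinfE => {}H.
have k0 : kappa != 0 by rewrite lt_eqF.
by apply: (mulfI k0); move: H; rewrite mulr0 => H; lra.
Qed.

(** * The tensor [phi] is parallel along the leaves *)

Definition dphi E F G : C := g (nabla_phi E F) G.

Lemma dphi_skew E F G : dphi E F G = - dphi E G F.
Proof.
have := nabla_metric LC E (phi F) G; rewrite {1}phi_skew vf_opp (nabla_metric LC).
rewrite (metricC g (phi F)) (metricC g F) => H.
rewrite /dphi /nabla_phi !metricE (phi_skew (nabla E F)) (phi_skew (nabla E G)).
by apply: (eq_lin (c := -1) H); cring.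
Qed.

Lemma dphiNr E F G : dphi E F (- G) = - dphi E F G.
Proof. exact: metricNr. Qed.
Lemma dphiZr E F f G : dphi E F (f *: G) = f * dphi E F G.
Proof. exact: metricZr. Qed.
Lemma dphiNm E F G : dphi E (- F) G = - dphi E F G.
Proof. by rewrite dphi_skew dphiNr (dphi_skew E F). Qed.
Lemma dphiZm E F f G : dphi E (f *: F) G = f * dphi E F G.
Proof. by rewrite dphi_skew dphiZr (dphi_skew E F) mulrN. Qed.

(** For a torsion-free connection [d Phi] is, up to sign, this cyclic sum. *)
Lemma dphi_cyclic E F G : dphi E F G + dphi F G E + dphi G E F = 0.
Proof.
have := dPhi E F G; rewrite /d2 /fundamental_form !(nabla_metric LC).
rewrite !(torsion_free LC) !metricE => H.
rewrite (dphi_skew E) (dphi_skew F) (dphi_skew G) /dphi /nabla_phi !metricE !phi_skew.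
rewrite (metricC g _ F) (metricC g _ G) (metricC g (nabla G (phi F)) E).
by apply: (eq_lin (c := -1) H); cring.
Qed.

Lemma dphi_phi E F G : perp F -> perp G -> dphi E (phi F) G = dphi E F (phi G).
Proof.
move=> F0 G0; have /(congr1 (g^~ G)) := nabla_phi_phi E F.
rewrite metricDl (metricDl _ (_ *: zeta)) !metricZl phi_skew F0 (metricC g zeta) G0 /dphi => H.
by apply: (eq_lin (c := 1) H); cring.
Qed.

Lemma nabla_shape_perp E F G : perp E -> perp F -> perp G ->
  g (nabla E (T F)) G = g (nabla E F) (T G).
Proof.
move=> E0 F0 G0; have := dshape0 E0 F0 G0; rewrite /dshape !metricE shape_sym => /eqP.
by rewrite subr_eq0 => /eqP.
Qed.

Lemma dphi_shape E F G : perp E -> perp F -> perp G ->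
  dphi E (T F) G = - dphi E F (T G).
Proof.
move=> E0 F0 G0; rewrite /dphi /nabla_phi phi_shape nablaN !metricE !phi_skew.
by rewrite !nabla_shape_perp ?g_phi_zeta// phi_shape !metricE; cring.
Qed.

(* On the leaves [b E F G = dphi E F (phi G)] is skew in [F, G]; the combination [w]
   below is moreover symmetric in [X, Y], hence zero. *)
Lemma dphi0 E F G : perp E -> perp F -> perp G -> dphi E F G = 0.
Proof.
pose b E F G := dphi E F (phi G).
have bskew X Y Z : perp Y -> perp Z -> b X Y Z = - b X Z Y.
  by move=> Y0 Z0; rewrite /b -dphi_phi// dphi_skew.
have bT X Y Z : perp X -> perp Y -> perp Z -> b X (T Y) Z = b X Y (T Z).
  move=> X0 Y0 Z0; rewrite /b dphi_shape ?g_phi_zeta// phi_shape.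
  by rewrite /dphi metricNr.
pose w X Y Z := b X (T Y) Z + b (T X) Y Z.
(* In the sum of two cyclic identities, the terms differentiated along [phi Z] cancel by
   [dphi_shape]. *)
have wsym X Y Z : perp X -> perp Y -> perp Z -> w X Y Z = w Y X Z.
  move=> X0 Y0 Z0; rewrite /w /b.
  have H1 := dphi_cyclic X (T Y) (phi Z).
  have H2 := dphi_cyclic (T X) Y (phi Z).
  have H3 := dphi_shape (g_phi_zeta Z) X0 Y0.
  rewrite (dphi_skew (T Y)) in H1; rewrite (dphi_skew Y) in H2.
  apply: CinfP => p; move: H1 H2 H3 => /(Cinf_at p) H1
    /(Cinf_at p) H2 /(Cinf_at p) H3.
  by move: H1 H2 H3; rewrite !CinfE => *; lra.
have wskew X Y Z : perp X -> perp Y -> perp Z -> w X Y Z = - w X Z Y.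
  move=> X0 Y0 Z0; rewrite /w (bskew (T X))// bT// bskew ?g_shape_zeta// bT//.
  by rewrite opprD.
have w0 X Y Z : perp X -> perp Y -> perp Z -> w X Y Z = 0.
  move=> X0 Y0 Z0.
  have H : w X Y Z = - w X Y Z.
    by rewrite {1}wsym// wskew// wsym// wskew// opprK wsym// wskew.
  apply: CinfP => p; have := Cinf_at p H.
  by rewrite !CinfE => ?; lra.
have bphi X Y Z : perp Y -> perp Z -> b X (phi Y) (phi Z) = - b X Y Z.
  by move=> Y0 Z0; rewrite /b (phi_zeta_perp Z0) dphiNr dphi_phi.
(* Replacing [Y, Z] by [phi Y, phi Z] keeps the first term of [w] and reverses the second, as [T]
   anticommutes with [phi]. So each term vanishes. *)
have bT0 X Y Z : perp X -> perp Y -> perp Z -> b X (T Y) Z = 0.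
  move=> X0 Y0 Z0; have H1 := w0 _ _ _ X0 Y0 Z0.
  have := w0 _ _ _ X0 (g_phi_zeta Y) (g_phi_zeta Z).
  rewrite /w shape_phi {1}/b dphiNm -/(b X _ _) !bphi ?g_shape_zeta// opprK => H2.
  rewrite /w in H1; apply: CinfP => p.
  move: H1 H2 => /(Cinf_at p) H1 /(Cinf_at p) H2.
  by move: H1 H2; rewrite !CinfE => *; lra.
move=> E0 F0 G0; have := bT0 E (T F) (phi G) E0 (g_shape_zeta F) (g_phi_zeta G).
rewrite /b (shape_shape_perp F0) (phi_zeta_perp G0) dphiNr dphiNm dphiZm opprK => H.
apply: CinfP => p; have := Cinf_at p H; rewrite !CinfE => {}H.
by apply/eqP; move/eqP: H; rewrite mulf_eq0 lt_eqF.
Qed.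

Lemma nabla_phi_perp E F G : perp E -> perp F -> perp G ->
  g (nabla E (phi F)) G = - g (nabla E F) (phi G).
Proof.
move=> E0 F0 G0; have := dphi0 E0 F0 G0; rewrite /dphi /nabla_phi !metricE phi_skew => H.
by apply: (eq_lin (c := 1) H); cring.
Qed.

(** * Connection and curvature of the leaves *)

Definition proj X : V := X - g X zeta *: zeta.
(** On fields orthogonal to [zeta] this is the Levi-Civita connection of the leaves, expressed by
    global fields instead of restrictions to submanifolds. *)
Definition leaf_nabla E F : V := proj (nabla E F).
Definition leaf_curv E F G : V :=
  leaf_nabla E (leaf_nabla F G) - leaf_nabla F (leaf_nabla E G) - leaf_nabla (bracket E F) G.

Lemma proj_perp X : perp (proj X).
Proof. by rewrite /proj !metricE g_zeta; cring. Qed.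

Lemma leaf_nabla_perp E F : perp (leaf_nabla E F).
Proof. exact: proj_perp. Qed.

Lemma g_proj X Z : g (proj X) Z = g X (proj Z).
Proof. by rewrite /proj !metricE (metricC g zeta); cring. Qed.

Lemma shape_proj X : T (proj X) = T X.
Proof. by rewrite /proj shapeD shapeN shapeZ shape_zeta scaler0 subr0. Qed.

Lemma phi_proj X : phi (proj X) = phi X.
Proof. by rewrite /proj phiD phiN phiZ phi_zeta scaler0 subr0. Qed.

Lemma leaf_nabla_shape E F : perp E -> perp F -> leaf_nabla E (T F) = T (leaf_nabla E F).
Proof.
move=> E0 F0; apply: ginj => Z; rewrite /leaf_nabla shape_proj g_proj.
by rewrite nabla_shape_perp ?proj_perp// shape_proj shape_sym.
Qed.

Lemma leaf_nabla_phi E F : perp E -> perp F -> leaf_nabla E (phi F) = phi (leaf_nabla E F).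
Proof.
move=> E0 F0; apply: ginj => Z; rewrite /leaf_nabla phi_proj g_proj.
by rewrite nabla_phi_perp ?proj_perp// phi_proj phi_skew.
Qed.

Lemma leaf_curv_shape E F G : perp E -> perp F -> perp G ->
  leaf_curv E F (T G) = T (leaf_curv E F G).
Proof.
move=> E0 F0 G0; rewrite /leaf_curv shapeD shapeN shapeD shapeN.
by rewrite !leaf_nabla_shape ?leaf_nabla_perp//; exact: g_bracket_zeta.
Qed.

Lemma leaf_curv_phi E F G : perp E -> perp F -> perp G ->
  leaf_curv E F (phi G) = phi (leaf_curv E F G).
Proof.
move=> E0 F0 G0; rewrite /leaf_curv phiD phiN phiD phiN.
by rewrite !leaf_nabla_phi ?leaf_nabla_perp//; exact: g_bracket_zeta.
Qed.

Lemma gauss E F G H : perp E -> perp F -> perp G -> perp H ->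
  g (leaf_curv E F G) H = g (curvature nabla E F G) H
     + g (T F) G * g (T E) H - g (T E) G * g (T F) H.
Proof.
move=> E0 F0 G0 H0.
have pH : proj H = H by rewrite /proj H0 scale0r subr0.
(* The projection removes the [zeta] component [- g (T Y) G] of [nabla Y G]; differentiating [zeta]
   along [X] turns it into a multiple of [T X]. *)
have nn X Y : perp X -> perp Y -> g (leaf_nabla X (leaf_nabla Y G)) H =
    g (nabla X (nabla Y G)) H + g (T Y) G * g (T X) H.
  move=> X0 Y0; rewrite /leaf_nabla g_proj pH {1}/proj g_nabla_zeta G0 vf_zero.
  rewrite nablaD nablaN nablaZ !metricE (metricC g zeta) H0 -/(T X) (metricC g G).
  by cring.
rewrite /leaf_curv /curvature metricDl metricNl metricDl metricNl !nn// /leaf_nabla g_proj pH.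
rewrite [in RHS]metricDl metricNl metricDl metricNl.
by cring.
Qed.

(* By the Gauss equation, [gauss_curv] is the curvature of the leaves on [ker eta],
   but it has the symmetries of a curvature tensor on all vector fields. *)
Definition gauss_curv E F G H : C := g (curvature nabla E F G) H
  + g (T F) G * g (T E) H - g (T E) G * g (T F) H.

Lemma gauss_curv_skew12 E F G H : gauss_curv E F G H = - gauss_curv F E G H.
Proof. by rewrite /gauss_curv curvatureC metricNl; cring. Qed.

Lemma gauss_curv_skew34 E F G H : gauss_curv E F G H = - gauss_curv E F H G.
Proof. by rewrite /gauss_curv (curvature_metric LC); cring. Qed.

Lemma gauss_curv_bianchi E F G H :
  gauss_curv E F G H + gauss_curv F G E H + gauss_curv G E F H = 0.
Proof.
have /(congr1 (g^~ H)) := curvature_bianchi LC E F G; rewrite metric0l 2!metricDl => B.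
rewrite /gauss_curv (shape_sym F G) (shape_sym E G) (shape_sym E F).
rewrite (metricC g F) (metricC g E (T G)) (metricC g E (T F)).
by apply: (eq_lin (c := 1) B); cring.
Qed.

(** The classical combination of four Bianchi identities with the two skew symmetries. *)
Lemma gauss_curv_pair E F G H : gauss_curv E F G H = gauss_curv G H E F.
Proof.
have at_p X Y Z W p := Cinf_at p (gauss_curv_bianchi X Y Z W).
have s12 X Y Z W p := Cinf_at p (gauss_curv_skew12 X Y Z W).
have s34 X Y Z W p := Cinf_at p (gauss_curv_skew34 X Y Z W).
apply: CinfP => p.
have := at_p E F G H p; have := at_p F G H E p; have := at_p G H E F p.
have := at_p H E F G p.
have := s34 E F H G p; have := s34 F G H E p; have := s34 G H F E p.
have := s34 H E G F p; have := s12 E G H F p; have := s34 G E H F p.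
have := s12 F H E G p; have := s34 H F E G p.
rewrite !CinfE => *; lra.
Qed.

Lemma gauss_curv_shape34 E F G H : perp E -> perp F -> perp G -> perp H ->
  gauss_curv E F (T G) H = gauss_curv E F G (T H).
Proof.
by move=> E0 F0 G0 H0; rewrite /gauss_curv -!gauss ?g_shape_zeta// leaf_curv_shape// shape_sym.
Qed.

Lemma gauss_curv_phi34 E F G H : perp E -> perp F -> perp G -> perp H ->
  gauss_curv E F (phi G) H = - gauss_curv E F G (phi H).
Proof.
by move=> E0 F0 G0 H0; rewrite /gauss_curv -!gauss ?g_phi_zeta// leaf_curv_phi// phi_skew.
Qed.

Lemma gauss_curv_shape12 E F G H : perp E -> perp F -> perp G -> perp H ->
  gauss_curv (T E) F G H = gauss_curv E (T F) G H.
Proof. by move=> *; rewrite gauss_curv_pair gauss_curv_shape34// gauss_curv_pair. Qed.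

(* Four Bianchi identities, with [T] on each of the arguments in turn. *)
Lemma gauss_curv_shape13 E F G H : perp E -> perp F -> perp G -> perp H ->
  gauss_curv (T E) F G H = gauss_curv E F (T G) H.
Proof.
move=> E0 F0 G0 H0; apply: CinfP => p.
have at_p X Y Z W := Cinf_at p (gauss_curv_bianchi X Y Z W).
have t12 X Y Z W (X0 : perp X) (Y0 : perp Y) (Z0 : perp Z) (W0 : perp W) :=
  Cinf_at p (gauss_curv_shape12 X0 Y0 Z0 W0).
have t34 X Y Z W (X0 : perp X) (Y0 : perp Y) (Z0 : perp Z) (W0 : perp W) :=
  Cinf_at p (gauss_curv_shape34 X0 Y0 Z0 W0).
have := at_p (T E) F G H; have := at_p E (T F) G H; have := at_p E F (T G) H.
have := at_p E F G (T H).
have := t12 _ _ _ _ E0 F0 G0 H0; have := t12 _ _ _ _ F0 G0 E0 H0.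
have := t12 _ _ _ _ G0 E0 F0 H0.
have := t34 _ _ _ _ E0 F0 G0 H0; have := t34 _ _ _ _ F0 G0 E0 H0.
have := t34 _ _ _ _ G0 E0 F0 H0.
by rewrite !CinfE => *; lra.
Qed.

Lemma gauss_curvN4 E F G H : gauss_curv E F G (- H) = - gauss_curv E F G H.
Proof. by rewrite /gauss_curv !metricNr; cring. Qed.
Lemma gauss_curvD4 E F G H X :
  gauss_curv E F G (H + X) = gauss_curv E F G H + gauss_curv E F G X.
Proof. by rewrite /gauss_curv !metricDr; cring. Qed.
Lemma gauss_curvZ4 E F G f H : gauss_curv E F G (f *: H) = f * gauss_curv E F G H.
Proof. by rewrite /gauss_curv !metricZr; cring. Qed.
Lemma gauss_curvN3 E F G H : gauss_curv E F (- G) H = - gauss_curv E F G H.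
Proof. by rewrite gauss_curv_skew34 gauss_curvN4 -gauss_curv_skew34. Qed.

(** Move [T] from slot 1 to slot 3, past [phi], and back again: the anticommutation makes
    [gauss_curv (T X) Y Z (phi W)] its own negative. Taking [W = phi (T H)] then produces [kappa]
    times the claimed quantity. *)
Lemma gauss_curv_perp E F G H :
  perp E -> perp F -> perp G -> perp H -> gauss_curv E F G H = 0.
Proof.
have phi0 X Y Z W : perp X -> perp Y -> perp Z -> perp W ->
    gauss_curv (T X) Y Z (phi W) = 0.
  move=> X0 Y0 Z0 W0.
  have := gauss_curv_phi34 (g_shape_zeta X) Y0 Z0 W0.
  rewrite gauss_curv_shape13 ?g_phi_zeta// shape_phi gauss_curvN3.
  rewrite gauss_curv_phi34 ?g_shape_zeta// opprK.
  rewrite -gauss_curv_shape13 ?g_phi_zeta// => H1; apply: CinfP => p.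
  by have := Cinf_at p H1; rewrite !CinfE => ?; lra.
move=> E0 F0 G0 H0; have := phi0 E F G (phi (T H)) E0 F0 G0 (g_phi_zeta _).
rewrite gauss_curv_shape13 ?g_phi_zeta// gauss_curv_shape34 ?g_phi_zeta//.
rewrite phi_zeta_perp ?g_shape_zeta//.
rewrite shapeN shape_shape_perp// opprK gauss_curvZ4 => H1.
apply: CinfP => p; have := Cinf_at p H1; rewrite !CinfE => {}H1.
by apply/eqP; move/eqP: H1; rewrite mulf_eq0 lt_eqF.
Qed.

Lemma gauss_curv_zeta3 E F H : gauss_curv E F zeta H = g (curvature nabla E F zeta) H.
Proof. by rewrite /gauss_curv !g_shape_zeta; cring. Qed.

(** [G] and [H] are split into their parts along the leaf and along [zeta]; the components with
    [zeta] are values of [K(E, F) zeta]. *)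
Lemma curvature_formula E F G H : g (curvature nabla E F G) H =
  g (T E) G * g (T F) H - g (T F) G * g (T E) H
  + g G zeta * g (curvature nabla E F zeta) H
  - g H zeta * g (curvature nabla E F zeta) G.
Proof.
suff : gauss_curv E F G H = g G zeta * gauss_curv E F zeta H - g H zeta * gauss_curv E F zeta G.
  rewrite !gauss_curv_zeta3 {1}/gauss_curv => H1.
  by apply: (eq_lin (c := 1) H1); cring.
have dec X : X = proj X + g X zeta *: zeta by rewrite /proj subrK.
have zz : gauss_curv E F zeta zeta = 0.
  apply: CinfP => p; have := Cinf_at p (gauss_curv_skew34 E F zeta zeta).
  by rewrite !CinfE => ?; lra.
(* [E] and [F] may have [zeta] components here. Pair symmetry moves them to the last two slots,
   where [curv_zeta_perp] removes them. *)
have gauss_curvp : gauss_curv E F (proj G) (proj H) = 0.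
  rewrite gauss_curv_pair {1}(dec F) (gauss_curv_skew34 _ _ E).
  have z3 X : gauss_curv (proj G) (proj H) zeta X = 0.
    by rewrite gauss_curv_zeta3 curv_zeta_perp ?proj_perp// metric0l.
  rewrite -gauss_curv_skew34 gauss_curvD4 gauss_curvZ4.
  rewrite (gauss_curv_skew34 _ _ E zeta) z3 oppr0 mulr0 addr0.
  rewrite gauss_curv_skew34 {1}(dec E) gauss_curvD4 gauss_curvZ4.
  rewrite (gauss_curv_skew34 _ _ _ zeta) z3 oppr0 mulr0 addr0.
  by rewrite gauss_curv_perp ?proj_perp// oppr0.
have gauss_curv3 X : gauss_curv E F X zeta = - gauss_curv E F zeta X by rewrite gauss_curv_skew34.
have zp X : gauss_curv E F zeta (proj X) = gauss_curv E F zeta X.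
  by rewrite {2}(dec X) gauss_curvD4 gauss_curvZ4 zz mulr0 addr0.
rewrite {1}(dec H) gauss_curvD4 gauss_curvZ4 gauss_curv3.
rewrite gauss_curv_skew34 {1}(dec G) gauss_curvD4 gauss_curvZ4.
rewrite (gauss_curv_skew34 _ _ _ (proj G)) gauss_curvp (gauss_curv3 (proj H)) zp.
by cring.
Qed.

(** * Ricci tensor and scalar curvature *)

Section Traces.
Variable p : M.
Local Notation e := (frame_at g p).

Lemma sum_frame_sq : \sum_i g (e i) (e i) p = d%:R.
Proof.
under eq_bigr do rewrite orthonormal_frame eqxx.
by rewrite sumr_const card_ord.
Qed.

(** From [T = phi T phi] and cyclicity, the trace of [T] is that of [T phi^2], which is its own
    negative. Cyclicity is an exchange of two frame sums. *)
Lemma trace_shape : \sum_i g (T (e i)) (e i) p = 0.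
Proof.
have H : \sum_i g (T (e i)) (e i) p = - \sum_i g (T (e i)) (e i) p.
  have E1 : \sum_i g (T (e i)) (e i) p =
      - \sum_i \sum_j g (T (phi (e i))) (e j) p * g (phi (e i)) (e j) p.
    rewrite -sumrN; apply: eq_bigr => i _.
    by rewrite parseval {1}shape_conj phi_skew CinfN.
  rewrite {1}E1 exchange_big /=; congr (- _); apply: eq_bigr => j _.
  under eq_bigr => i _ do rewrite shape_sym !phi_skew !CinfN mulrNN !(metricC g (e i)).
  by rewrite parseval phi_compat g_shape_zeta !CinfE mul0r subr0.
by lra.
Qed.

(** A skew operator times a symmetric one has trace zero. *)
Lemma trace_phi_shape : \sum_i g (phi (T (e i))) (e i) p = 0.
Proof.
have H : \sum_i g (phi (T (e i))) (e i) p = - \sum_i g (phi (T (e i))) (e i) p.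
  have E1 : \sum_i g (phi (T (e i))) (e i) p = - \sum_i g (T (e i)) (phi (e i)) p.
    by rewrite -sumrN; apply: eq_bigr => i _; rewrite phi_skew CinfN.
  rewrite {1}E1.
  have -> : \sum_i g (T (e i)) (phi (e i)) p =
      \sum_i \sum_j g (T (e i)) (e j) p * g (phi (e i)) (e j) p.
    by apply: eq_bigr => i _; rewrite parseval.
  rewrite exchange_big /= E1 opprK -sumrN; apply: eq_bigr => j _.
  under eq_bigr => i _ do rewrite shape_sym phi_skew CinfN mulrN !(metricC g (e i)).
  by rewrite sumrN parseval opprK.
by lra.
Qed.

(** Each summand is arranged so that every sum over the frame is a trace or an instance of
    [parseval]. The [kappa * g E F] term cancels against [g (T F) (T E)] by [shape_shape]. *)
Lemma ricci_formula E F : ricci g nabla E F p =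
  (d%:R - 1) * kappa * (g E zeta p * g F zeta p) + mu * g (phi (T E)) F p.
Proof.
rewrite /ricci.
transitivity (\sum_i (g (T F) (e i) p * g (T E) (e i) p
   - g (T E) F p * g (T (e i)) (e i) p
   + g F zeta p * (kappa * (g E zeta p * g (e i) (e i) p - g zeta (e i) p * g E (e i) p)
        + mu * (g E zeta p * g (phi (T (e i))) (e i) p - g zeta (e i) p * g (phi (T E)) (e i) p))
   - (kappa * (g E zeta p * (g zeta (e i) p * g F (e i) p)
          - g E F p * (g zeta (e i) p * g zeta (e i) p))
      + mu * (- g E zeta p * (g zeta (e i) p * g (T (phi F)) (e i) p)
         - g (phi (T E)) F p * (g zeta (e i) p * g zeta (e i) p))))).
  apply: eq_bigr => i _.
  rewrite curvature_formula curv_zeta !metricE !CinfE.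
  rewrite (metricC g zeta) (metricC g F (e i)) (shape_sym (e i) F) (metricC g (T F)).
  rewrite (phi_skew (T (e i)) F) (shape_sym (e i) (phi F)) (metricC g (T (phi F))) !CinfE.
  by ring.
rewrite !(big_split, sumrN, =^~ mulr_sumr) /=.
rewrite !parseval sum_frame_sq trace_shape trace_phi_shape.
rewrite g_zeta Cinf1 (metricC g zeta (phi _)) g_phi_zeta Cinf0.
rewrite (metricC g zeta (T _)) g_shape_zeta Cinf0.
rewrite -shape_sym shape_shape !metricE !CinfE (metricC g F E) (metricC g zeta E) (metricC g zeta F).
by ring.
Qed.

Lemma scalar_curvature_formula :
  scalar_curvature g nabla p = (d%:R - 1) * kappa.
Proof.
rewrite /scalar_curvature; under eq_bigr do rewrite ricci_formula !(metricC g (e _) zeta).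
by rewrite big_split /= -!mulr_sumr trace_phi_shape parseval g_zeta Cinf1 mulr1 mulr0 addr0.
Qed.
End Traces.

(** * Exclusion of quasi-Einstein structures *)

Lemma no_quasi_einstein (omega : C) (rho lambda1 : R) (m : \bar R) :
  (1 < d)%N -> compact [set: M] -> (0 < m)%E ->
  is_gradient g omega (zeta omega *: zeta) ->
  quasi_einstein g nabla m rho omega lambda1 -> False.
Proof.
move=> d1 cM m0 grad qe; set f := zeta omega in grad.
have [p _ fmax] : exists2 p, p \in [set: M] & forall t, t \in [set: M] -> f t <= f p.
  apply: compact_EVT_max => //; first exact: mfd_nonempty.
  by apply: continuous_subspaceT; exact: Cinf_continuous.
have Xf0 X : X f p = 0 by apply: vf_at_max => q; apply: fmax; rewrite inE.
have dw E : E omega = f * g E zeta by rewrite -grad metricZl metricC.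
(* In general the Hessian also contains [E f * g F zeta], which vanishes at the maximum [p] of
   [f]. *)
have hess E F : hessian nabla omega E F p = f p * g (T E) F p.
  by rewrite /hessian !dw vfM g_nabla_zeta !CinfE Xf0 (metricC g F (T E)); ring.
have minv : 0 <= fine (m^-1)%E by rewrite fine_ge0// inve_ge0 ltW.
set c := fine _ in minv.
set s := rho * scalar_curvature g nabla p + lambda1.
have zz : (d%:R - 1) * kappa - c * (f p * f p) = s.
  have := qe zeta zeta p.
  rewrite hess ricci_formula shape_zeta phi0 !metric0l g_zeta !CinfE -/c -/s.
  by rewrite /f => H; lra.
have tr : (d%:R - 1) * kappa - c * (f p * f p) = s * d%:R.
  have : \sum_i (ricci g nabla (frame_at g p i) (frame_at g p i) p
      + f p * g (T (frame_at g p i)) (frame_at g p i) p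
      - c * (f p * f p * (g zeta (frame_at g p i) p * g zeta (frame_at g p i) p))) =
      \sum_i s * g (frame_at g p i) (frame_at g p i) p.
    apply: eq_bigr => i _; rewrite -qe hess !dw !CinfE (metricC g _ zeta) -/c.
    by ring.
  rewrite !(big_split, sumrN, =^~ mulr_sumr) /= -/(scalar_curvature g nabla p).
  rewrite trace_shape parseval sum_frame_sq scalar_curvature_formula g_zeta Cinf1.
  by rewrite mulr0 addr0 mulr1.
have d1' : 1 < d%:R :> R by rewrite ltr1n.
have s0 : s = 0.
  have : s * (d%:R - 1) = 0 by rewrite mulrBr mulr1 -tr zz subrr.
  by move/eqP; rewrite mulf_eq0 subr_eq0 (gt_eqF d1') orbF => /eqP.
have cf : 0 <= c * (f p * f p) by rewrite mulr_ge0// -expr2 sqr_ge0.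
have : (d%:R - 1) * kappa < 0 by rewrite pmulr_rlt0// subr_gt0.
by move: zz; rewrite s0; lra.
Qed.

End AlmostContact.

Theorem theorem1p3 (R : realType) (n : nat) (n_gt0 : (0 < n)%N)
    (M : smoothManifold R (2 * n).+1%N) (S : almost_contact_metric M)
    (nabla : connection M) (kappa mu : R) :
  compact [set: M] ->
  levi_civita (acm_metric S) nabla ->
  kappa < 0 ->
  kappa_mu_almost_cokahler S nabla kappa mu ->
  ~ exists (omega : Cinf M) (rho lambda1 : R) (m : \bar R) (D : vecfield M),
      [/\ (0 < m)%E,
          is_gradient (acm_metric S) omega D,
          D = acm_zeta S omega *: acm_zeta S &
          quasi_einstein (acm_metric S) nabla m rho omega lambda1].
Proof.
move=> cM LC kappa0 [[deta dPhi] KM] [omega [rho [lambda1 [m [D [m0 grad DE qe]]]]]].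
rewrite DE in grad.
apply: (no_quasi_einstein LC deta dPhi kappa0 KM _ cM m0 grad qe).
(* The dimension must exceed 1 for [(d - 1) * kappa] to be negative; this is where [n_gt0]
   enters. *)
by rewrite ltnS muln_gt0.
Qed.
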